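(* Let $\mathsf{C}\subset\mathsf{Ab}$ denote the full subcategory of reduced cotorsion abelian groups in the category $\mathsf{Ab}$ of abelian groups. Then: (a) The full subcategory $\mathsf{C}$ is closed under kernels, cokernels, extensions, and infinite products in $\mathsf{Ab}$. In particular, $\mathsf{C}$ is an abelian category and its embedding $\mathsf{C}\to\mathsf{Ab}$ is an exact functor. (b) The functor $(C_p)_p\longmapsto\prod_p C_p$ establishes an equivalence between the Cartesian product, taken over all prime numbers $p$, of the abelian categories of $p$-contramodule abelian groups, and the category $\mathsf{C}$.
   Context: An abelian group $C$ is cotorsion if $\operatorname{Ext}^1_{\mathbb Z}(F,C)=0$ for every flat (equivalently, torsion-free) abelian group $F$. An abelian group is reduced if it has no nonzero divisible subgroups. For a prime number $p$, an abelian group $C$ is a $p$-contramodule if $\operatorname{Hom}_{\mathbb Z}(\mathbb Z[p^{-1}],C)=0=\operatorname{Ext}^1_{\mathbb Z}(\mathbb Z[p^{-1}],C)$; the $p$-contramodule abelian groups are viewed as a full subcategory of $\mathsf{Ab}$. A full subcategory is closed under kernels (cokernels) if for every morphism between two of its objects the kernel (cokernel) computed in the ambient category belongs to it. *)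

(* Defs.v *)
From HB Require Import structures.
From mathcomp Require Import all_boot all_order all_algebra.
From mathcomp Require Import boolp classical_sets functions.

Set Implicit Arguments.
Unset Strict Implicit.
Unset Printing Implicit Defensive.

Import GRing.Theory Num.Theory.
Local Open Scope ring_scope.

Record category := Category {
  Ob :> Type;
  Hom : Ob -> Ob -> Type;
  idm : forall X : Ob, Hom X X;
  comp : forall X Y Z : Ob, Hom Y Z -> Hom X Y -> Hom X Z;
  comp1m : forall (X Y : Ob) (f : Hom X Y), comp (idm Y) f = f;
  compm1 : forall (X Y : Ob) (f : Hom X Y), comp f (idm X) = f;
  compA : forall (W X Y Z : Ob) (h : Hom Y Z) (g : Hom X Y) (f : Hom W X),
    comp h (comp g f) = comp (comp h g) f }.

Arguments Hom {c} _ _.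
Arguments idm {c} _.
Arguments comp {c X Y Z} _ _.

Declare Scope cat_scope.
Delimit Scope cat_scope with cat.
Local Open Scope cat_scope.
Notation "g ∘ f" := (comp g f) (at level 40, left associativity) : cat_scope.

Record functor (C D : category) := Functor {
  fob :> C -> D;
  fmap : forall X Y : C, Hom X Y -> Hom (fob X) (fob Y);
  fmap1 : forall X : C, fmap (idm X) = idm (fob X);
  fmapM : forall (X Y Z : C) (g : Hom Y Z) (f : Hom X Y),
    fmap (g ∘ f) = fmap g ∘ fmap f }.

Arguments fmap {C D} _ {X Y} _.

Section CategoryNotions.
Variable C : category.
Implicit Types A B X Y Z : C.

Definition is_iso X Y (f : Hom X Y) : Prop :=
  exists g : Hom Y X, g ∘ f = idm X /\ f ∘ g = idm Y.

Definition is_mono X Y (f : Hom X Y) : Prop :=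
  forall W (g h : Hom W X), f ∘ g = f ∘ h -> g = h.

Definition is_epi X Y (f : Hom X Y) : Prop :=
  forall W (g h : Hom Y W), g ∘ f = h ∘ f -> g = h.

Definition is_zero_object Z : Prop :=
  (forall X, exists! f : Hom X Z, True) /\ (forall X, exists! f : Hom Z X, True).

Definition is_zero_mor X Y (f : Hom X Y) : Prop :=
  exists (Z : C) (b : Hom Z Y) (a : Hom X Z), is_zero_object Z /\ f = b ∘ a.

Definition is_kernel A B (f : Hom A B) K (k : Hom K A) : Prop :=
  is_zero_mor (f ∘ k) /\
  forall W (g : Hom W A), is_zero_mor (f ∘ g) -> exists! u : Hom W K, k ∘ u = g.

Definition is_cokernel A B (f : Hom A B) Q (q : Hom B Q) : Prop :=
  is_zero_mor (q ∘ f) /\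
  forall W (g : Hom B W), is_zero_mor (g ∘ f) -> exists! u : Hom Q W, u ∘ q = g.

Definition is_product X Y P (p : Hom P X) (q : Hom P Y) : Prop :=
  forall W (f : Hom W X) (g : Hom W Y),
    exists! u : Hom W P, p ∘ u = f /\ q ∘ u = g.

Definition is_coproduct X Y S (i : Hom X S) (j : Hom Y S) : Prop :=
  forall W (f : Hom X W) (g : Hom Y W),
    exists! u : Hom S W, u ∘ i = f /\ u ∘ j = g.

Definition is_short_exact X Y Z (f : Hom X Y) (g : Hom Y Z) : Prop :=
  is_kernel g f /\ is_cokernel f g.

Definition closed_under_kernels (P : C -> Prop) : Prop :=
  forall A B (f : Hom A B) K (k : Hom K A),
    P A -> P B -> is_kernel f k -> P K.

Definition closed_under_cokernels (P : C -> Prop) : Prop :=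
  forall A B (f : Hom A B) Q (q : Hom B Q),
    P A -> P B -> is_cokernel f q -> P Q.

End CategoryNotions.

(* Freyd's definition; the additive structure on the Hom sets is then uniquely
   determined, so being abelian is a property of the bare category. *)
Record is_abelian (C : category) : Prop := IsAbelian {
  abelian_zero : exists Z : C, is_zero_object Z;
  abelian_product : forall X Y : C,
    exists (P : C) (p : Hom P X) (q : Hom P Y), is_product p q;
  abelian_coproduct : forall X Y : C,
    exists (S : C) (i : Hom X S) (j : Hom Y S), is_coproduct i j;
  abelian_kernel : forall (A B : C) (f : Hom A B),
    exists (K : C) (k : Hom K A), is_kernel f k;
  abelian_cokernel : forall (A B : C) (f : Hom A B),
    exists (Q : C) (q : Hom B Q), is_cokernel f q;
  abelian_mono : forall (A B : C) (f : Hom A B), is_mono f ->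
    exists (Q : C) (g : Hom B Q), is_kernel g f;
  abelian_epi : forall (A B : C) (f : Hom A B), is_epi f ->
    exists (K : C) (g : Hom K A), is_cokernel g f }.

(* Additivity is not required separately: a functor between abelian categories
   taking short exact sequences to short exact sequences is additive. *)
Definition is_exact_functor (C D : category) (F : functor C D) : Prop :=
  forall (X Y Z : C) (f : Hom X Y) (g : Hom Y Z),
    is_short_exact f g -> is_short_exact (fmap F f) (fmap F g).

Definition id_functor (C : category) : functor C C :=
  @Functor C C (fun X => X) (fun X Y f => f)
    (fun X => erefl) (fun X Y Z g f => erefl).

Section FunctorComposition.
Variables (C D E : category) (G : functor D E) (F : functor C D).

Fact comp_functor1 (X : C) : fmap G (fmap F (idm X)) = idm (G (F X)).
Proof. by rewrite !fmap1. Qed.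

Fact comp_functorM (X Y Z : C) (g : Hom Y Z) (f : Hom X Y) :
  fmap G (fmap F (g ∘ f)) = fmap G (fmap F g) ∘ fmap G (fmap F f).
Proof. by rewrite !fmapM. Qed.

Definition comp_functor : functor C E :=
  @Functor C E (fun X => G (F X)) (fun X Y f => fmap G (fmap F f))
    comp_functor1 comp_functorM.

End FunctorComposition.

Definition nat_isomorphic (C D : category) (F G : functor C D) : Prop :=
  exists eta : forall X : C, Hom (F X) (G X),
    (forall X, is_iso (eta X)) /\
    (forall (X Y : C) (f : Hom X Y), eta Y ∘ fmap F f = fmap G f ∘ eta X).

Definition is_equivalence (C D : category) (F : functor C D) : Prop :=
  exists G : functor D C,
    nat_isomorphic (comp_functor G F) (id_functor C) /\
    nat_isomorphic (comp_functor F G) (id_functor D).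

Definition full_subcategory (C : category) (P : C -> Prop) : category :=
  @Category {X : C | P X} (fun X Y => @Hom C (sval X) (sval Y))
    (fun X => idm (sval X)) (fun X Y Z g f => g ∘ f)
    (fun X Y f => comp1m f) (fun X Y f => compm1 f)
    (fun W X Y Z h g f => compA h g f).

Definition inclusion_functor (C : category) (P : C -> Prop) :
    functor (full_subcategory P) C :=
  @Functor (full_subcategory P) C (fun X => sval X) (fun X Y f => f)
    (fun X => erefl) (fun X Y Z g f => erefl).

Definition corestrict_functor (C D : category) (P : D -> Prop)
    (F : functor C D) (FP : forall X : C, P (F X)) :
    functor C (full_subcategory P) :=
  @Functor C (full_subcategory P) (fun X => exist P (F X) (FP X))
    (fun X Y f => fmap F f) (fun X => fmap1 F X) (fun X Y Z g f => fmapM F g f).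

Section ProductCategory.
Variables (I : Type) (C : I -> category).

Definition product_category : category :=
  @Category (forall i, C i) (fun X Y => forall i, Hom (X i) (Y i))
    (fun X i => idm (X i)) (fun X Y Z g f i => g i ∘ f i)
    (fun X Y f => functional_extensionality_dep (fun i => comp1m (f i)))
    (fun X Y f => functional_extensionality_dep (fun i => compm1 (f i)))
    (fun W X Y Z h g f =>
       functional_extensionality_dep (fun i => compA (h i) (g i) (f i))).

End ProductCategory.

Definition additive_id (A : zmodType) : {additive A -> A} := idfun.

Definition additive_comp (A B C : zmodType)
    (g : {additive B -> C}) (f : {additive A -> B}) : {additive A -> C} :=
  g \o f.

Lemma additive_ext (A B : zmodType) (f g : {additive A -> B}) :
  f =1 g -> f = g.
Proof.
case: f => f cf; case: g => g cg /= /funext efg; subst g.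
congr Algebra.Additive.Pack; case: cf => -[fP]; case: cg => -[gP].
by rewrite (Prop_irrelevance fP gP).
Qed.

Fact additive_comp1m (A B : zmodType) (f : {additive A -> B}) :
  additive_comp (additive_id B) f = f.
Proof. exact: additive_ext. Qed.

Fact additive_compm1 (A B : zmodType) (f : {additive A -> B}) :
  additive_comp f (additive_id A) = f.
Proof. exact: additive_ext. Qed.

Fact additive_compA (A B C D : zmodType) (h : {additive C -> D})
    (g : {additive B -> C}) (f : {additive A -> B}) :
  additive_comp h (additive_comp g f) = additive_comp (additive_comp h g) f.
Proof. exact: additive_ext. Qed.

Definition Ab : category :=
  @Category zmodType (fun A B => {additive A -> B}) additive_id additive_comp
    additive_comp1m additive_compm1 additive_compA.

Section ProductGroup.
Variables (I : Type) (A : I -> zmodType).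

Definition product_group : Type := forall i, A i.

HB.instance Definition _ := Choice.on product_group.

Implicit Types x y z : product_group.

Definition product_zero : product_group := fun i => 0.
Definition product_opp x : product_group := fun i => - x i.
Definition product_add x y : product_group := fun i => x i + y i.

Fact product_addA : associative product_add.
Proof. by move=> x y z; apply: functional_extensionality_dep => i; exact: addrA. Qed.

Fact product_addC : commutative product_add.
Proof. by move=> x y; apply: functional_extensionality_dep => i; exact: addrC. Qed.

Fact product_add0 : left_id product_zero product_add.
Proof. by move=> x; apply: functional_extensionality_dep => i; exact: add0r. Qed.

Fact product_addN : left_inverse product_zero product_opp product_add.
Proof. by move=> x; apply: functional_extensionality_dep => i; exact: addNr. Qed.

HB.instance Definition _ := GRing.isZmodule.Build product_group
  product_addA product_addC product_add0 product_addN.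

End ProductGroup.

Section ProductMap.
Variables (I : Type) (A B : I -> zmodType).
Variable f : forall i, {additive A i -> B i}.

Definition product_map (x : product_group A) : product_group B :=
  fun i => f i (x i).

Fact product_map_additive : zmod_morphism product_map.
Proof.
by move=> x y; apply: functional_extensionality_dep => i; exact: raddfB.
Qed.

HB.instance Definition _ := GRing.isZmodMorphism.Build
  (product_group A) (product_group B) product_map product_map_additive.

End ProductMap.

Definition closed_under_products (P : zmodType -> Prop) : Prop :=
  forall (I : Type) (A : I -> zmodType), (forall i, P (A i)) ->
    P (product_group A).

(* Short exact sequences 0 -> C -> E -> F -> 0. *)
Record extension (F C : zmodType) := Extension {
  ext_mid :> zmodType;
  ext_in : {additive C -> ext_mid};
  ext_out : {additive ext_mid -> F};
  ext_in_inj : injective ext_in;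
  ext_out_surj : forall x : F, exists e, ext_out e = x;
  ext_exact : forall e, ext_out e = 0 <-> exists c, ext_in c = e }.

Definition ext_equiv (F C : zmodType) (X Y : extension F C) : Prop :=
  exists h : {additive X -> Y},
    [/\ bijective h, forall c, h (ext_in X c) = ext_in Y c
      & forall e, ext_out Y (h e) = ext_out X e].

Section SplitExtension.
Variables F C : zmodType.

Definition split_in (c : C) : C * F := (c, 0).

Fact split_in_additive : zmod_morphism split_in.
Proof. by move=> x y; congr pair; rewrite subr0. Qed.

HB.instance Definition _ := GRing.isZmodMorphism.Build C (C * F)%type
  split_in split_in_additive.

Definition split_out (e : C * F) : F := e.2.

Fact split_out_additive : zmod_morphism split_out.
Proof. by []. Qed.

HB.instance Definition _ := GRing.isZmodMorphism.Build (C * F)%type F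
  split_out split_out_additive.

Fact split_in_inj : injective split_in.
Proof. by move=> x y []. Qed.

Fact split_out_surj (x : F) : exists e, split_out e = x.
Proof. by exists (0, x). Qed.

Fact split_exact (e : C * F) : split_out e = 0 <-> exists c, split_in c = e.
Proof.
by split=> [|[c <-]//]; case: e => c x /= ->; exists c.
Qed.

Definition split_extension : extension F C :=
  @Extension F C (C * F)%type split_in split_out
    split_in_inj split_out_surj split_exact.

End SplitExtension.

(* Ext^1_Z(F, C) is the group of equivalence classes of extensions of F by C
   under Baer sum, whose zero is the class of the split extension. *)
Definition Ext1_zero (F C : zmodType) : Prop :=
  forall X : extension F C, ext_equiv X (split_extension F C).

Definition Hom_zero (A B : zmodType) : Prop :=
  forall (f : {additive A -> B}) (x : A), f x = 0.

Definition closed_under_extensions (P : zmodType -> Prop) : Prop :=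
  forall (F C : zmodType) (X : extension F C), P C -> P F -> P (ext_mid X).

Definition biadditive (A B W : zmodType) (b : A -> B -> W) : Prop :=
  (forall x, zmod_morphism (b x)) /\ (forall y, zmod_morphism (b ^~ y)).

Definition is_tensor (A B T : zmodType) (t : A -> B -> T) : Prop :=
  biadditive t /\
  forall (W : zmodType) (b : A -> B -> W), biadditive b ->
    exists! h : {additive T -> W}, forall x y, h (t x y) = b x y.

(* Tensoring with F preserves injectivity; h is the induced map f (x) F. *)
Definition flat (F : zmodType) : Prop :=
  forall (A B : zmodType) (f : {additive A -> B})
         (TA TB : zmodType) (tA : A -> F -> TA) (tB : B -> F -> TB)
         (h : {additive TA -> TB}),
    is_tensor tA -> is_tensor tB ->
    (forall a x, h (tA a x) = tB (f a) x) ->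
    injective f -> injective h.

Definition cotorsion (C : zmodType) : Prop :=
  forall F : zmodType, flat F -> Ext1_zero F C.

Definition divisible_in (C : zmodType) (D : {pred C}) : Prop :=
  forall (n : nat) (x : C), (0 < n)%N -> x \in D ->
    exists2 y : C, y \in D & y *+ n = x.

Definition reduced (C : zmodType) : Prop :=
  forall D : {pred C}, zmod_closed D -> divisible_in D ->
    forall x, x \in D -> x = 0.

Definition reduced_cotorsion (C : zmodType) : Prop := reduced C /\ cotorsion C.

Definition prime_number := {p : nat | prime p}.

Section LocalizedIntegers.
Variable p : prime_number.

Definition Zinv_pred : {pred rat} := fun x =>
  `[< exists (m : int) (n : nat), x = m%:~R / (val p)%:R ^+ n >].

Fact Zinv_zmod_closed : zmod_closed Zinv_pred.
Proof.
have p0 : (val p)%:R != 0 :> rat.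
  by rewrite pnatr_eq0 -lt0n prime_gt0 //; exact: valP.
split=> [|x y]; first by apply/asboolP; exists 0, 0%N; rewrite mul0r.
move=> /asboolP[m [n ->]] /asboolP[m' [n' ->]]; apply/asboolP.
exists (m * (val p)%:R ^+ n' - m' * (val p)%:R ^+ n), (n + n')%N.
by rewrite rmorphB !rmorphM !rmorphXn /= !rmorph_nat exprD
  -[- (_ / _)]mulNr addf_div ?expf_neq0 // mulNr.
Qed.

HB.instance Definition _ := GRing.isZmodClosed.Build rat Zinv_pred
  Zinv_zmod_closed.

(* The additive group of the subring Z[1/p] of the rationals. *)
Record Zinv := MkZinv { Zinv_val :> rat; _ : Zinv_val \in Zinv_pred }.

HB.instance Definition _ := [isSub for Zinv_val].
HB.instance Definition _ := [Choice of Zinv by <:].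
HB.instance Definition _ := [SubChoice_isSubZmodule of Zinv by <:].

Definition contramodule (C : zmodType) : Prop :=
  Hom_zero Zinv C /\ Ext1_zero Zinv C.

End LocalizedIntegers.

Definition RedCot : category := @full_subcategory Ab reduced_cotorsion.

Definition Contra (p : prime_number) : category :=
  @full_subcategory Ab (contramodule p).

Definition product_functor_map (X Y : product_category Contra) (f : Hom X Y) :
    {additive product_group (fun p => sval (X p)) ->
              product_group (fun p => sval (Y p))} :=
  product_map f.

Fact product_functor1 (X : product_category Contra) :
  product_functor_map (idm X) = additive_id _.
Proof. exact: additive_ext. Qed.

Fact product_functorM (X Y Z : product_category Contra)
    (g : Hom Y Z) (f : Hom X Y) :
  product_functor_map (g ∘ f)
    = additive_comp (product_functor_map g) (product_functor_map f).
Proof. exact: additive_ext. Qed.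

Definition product_functor : functor (product_category Contra) Ab :=
  @Functor (product_category Contra) Ab
    (fun X => product_group (fun p => sval (X p)))
    product_functor_map product_functor1 product_functorM.

(* Main.v *)
(* Call a group C "m-telescopic", for a sequence m of positive integers, if
   c n = a n + m n * c n.+1 has a unique solution c for every sequence a in C.
   For a torsion-free group R of rank one, generated by elements with
   e n = m n * e n.+1, this says exactly that Hom(R, C) = 0 = Ext^1(R, C).
   So p-contramodules are the groups telescopic for the constant sequence p,
   and, Q being flat, a reduced cotorsion group is telescopic for every m whose
   products are cofinal for divisibility.  Telescopic groups are stable under
   kernels, cokernels, extensions and products by diagram chasing.
   Conversely, if C is telescopic for all these m, then the exact sequence
   0 -> Z -> Z_(p) (+) Z[1/p] -> Q -> 0 splits off from C a p-contramodule, the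
   image of Hom(Z_(p), C), and C is the product of these over all p.  A
   p-contramodule P satisfies Ext^1(F, P) = 0 for all F without p-torsion, by
   Zorn's lemma on p-pure partial splittings, so C is cotorsion.  The product
   functor is fully faithful because a p-contramodule is q-divisible for every
   prime q <> p, whereas a q-contramodule receives no nonzero homomorphism
   from a q-divisible group. *)

From HB Require Import structures.
From mathcomp Require Import all_boot all_order all_algebra.
From mathcomp Require Import boolp classical_sets functions.
From mathcomp Require Import ring.
Require Import Defs.

Set Implicit Arguments.
Unset Strict Implicit.
Unset Printing Implicit Defensive.

Import GRing.Theory Num.Theory.
Local Open Scope ring_scope.

(* The square-zero extension of Z by V: a commutative ring containing V, through
   which the ring tactic decides identities in the abelian group V. *)
Section SquareZeroExtension.
Variable V : zmodType.

Definition sqzero : Type := (int * V)%type.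
HB.instance Definition _ := GRing.Zmodule.on sqzero.

Definition sqzero_mul (a b : sqzero) : sqzero :=
  (a.1 * b.1, a.2 *~ b.1 + b.2 *~ a.1).

Fact sqzero_mulA : associative sqzero_mul.
Proof.
move=> [a u] [b v] [c w]; congr pair; first exact: mulrA.
by rewrite /= !mulrzDl -!mulrzA addrA [c * a]mulrC [b * c]mulrC [b * a]mulrC.
Qed.

Fact sqzero_mulC : commutative sqzero_mul.
Proof. by move=> [a u] [b v]; congr pair; [exact: mulrC | exact: addrC]. Qed.

Fact sqzero_mul1 : left_id ((1, 0) : sqzero) sqzero_mul.
Proof. by move=> [a u]; congr pair; rewrite /= ?mul1r // mul0rz add0r. Qed.

Fact sqzero_mulD : left_distributive sqzero_mul +%R.
Proof.
move=> [a u] [b v] [c w]; congr pair; first exact: mulrDl.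
by rewrite /= mulrzDl mulrzDr addrACA.
Qed.

HB.instance Definition _ := GRing.Zmodule_isComPzRing.Build sqzero
  sqzero_mulA sqzero_mulC sqzero_mul1 sqzero_mulD.

Definition sqzero_in (v : V) : sqzero := (0, v).

Fact sqzero_in_additive : zmod_morphism sqzero_in.
Proof. by move=> x y; congr pair; rewrite subr0. Qed.

HB.instance Definition _ := GRing.isZmodMorphism.Build V sqzero
  sqzero_in sqzero_in_additive.

Lemma sqzero_in_inj : injective sqzero_in.
Proof. by move=> x y []. Qed.

End SquareZeroExtension.

Local Ltac zmod := apply: sqzero_in_inj; ring.

(** * Homomorphisms, subgroups and quotients *)

Lemma additive_of_fun (A B : zmodType) (f : A -> B) : zmod_morphism f ->
  exists g : {additive A -> B}, g =1 f.
Proof.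
move=> fB; pose m := GRing.isZmodMorphism.Build A B f fB.
by exists (HB.pack_for {additive A -> B} f m).
Qed.

(** Compatibility with subtraction and triviality over 0 make R single-valued, so any choice
    function for R is additive. Homomorphisms whose definition involves choices are built this
    way. *)
Lemma additive_of_graph (A B : zmodType) (R : A -> B -> Prop) :
    (forall x, exists y, R x y) ->
    (forall x x' y y', R x y -> R x' y' -> R (x - x') (y - y')) ->
    (forall y, R 0 y -> y = 0) ->
  exists f : {additive A -> B}, forall x, R x (f x).
Proof.
move=> tot sub fct; have [f fP] := choice tot.
have [|g gf] := @additive_of_fun A B f; last by exists g => x; rewrite gf.
move=> x y; apply/eqP; rewrite -subr_eq0; apply/eqP/fct.
by rewrite -(subrr (x - y)); exact/sub/sub.
Qed.

Definition onto (T U : Type) (f : T -> U) := forall y, exists x, f x = y.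

Lemma raddf_inj0 (A B : zmodType) (f : {additive A -> B}) :
  (forall x, f x = 0 -> x = 0) -> injective f.
Proof.
by move=> f0 x y e; apply/eqP; rewrite -subr_eq0; apply/eqP/f0; rewrite raddfB e subrr.
Qed.

Lemma inj_raddf0 (A B : zmodType) (f : {additive A -> B}) :
  injective f -> forall x, f x = 0 -> x = 0.
Proof. by move=> fI x fx0; apply: fI; rewrite fx0 raddf0. Qed.

Lemma additive_inverse (A B : zmodType) (f : {additive A -> B}) :
  injective f -> onto f ->
  exists g : {additive B -> A}, cancel f g /\ cancel g f.
Proof.
move=> fI fS.
have [//|x x' y y' <- <-|y /(inj_raddf0 fI)//|g gP] :=
  @additive_of_graph B A (fun x y => f y = x); first exact: raddfB.
by exists g; split=> x; [apply: fI; rewrite gP | rewrite gP].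
Qed.

Definition exact (A B C : zmodType) (f : {additive A -> B})
    (g : {additive B -> C}) : Prop :=
  forall y, g y = 0 <-> exists x, f x = y.

Definition subgroup (V : zmodType) (P : V -> Prop) : Prop :=
  P 0 /\ forall x y, P x -> P y -> P (x - y).

Section Subgroup.
Variables (V : zmodType) (P : V -> Prop).
Hypothesis sgP : subgroup P.

Lemma sg0 : P 0. Proof. by case: sgP. Qed.
Lemma sgB x y : P x -> P y -> P (x - y). Proof. by case: sgP => _; exact. Qed.
Lemma sgN x : P x -> P (- x).
Proof. by rewrite -[- x]sub0r; apply: sgB; exact: sg0. Qed.
Lemma sgD x y : P x -> P y -> P (x + y).
Proof. by move=> ? ?; rewrite -[y]opprK; apply: sgB => //; exact: sgN. Qed.
Lemma sgMn x n : P x -> P (x *+ n).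
Proof.
by move=> Px; elim: n => [|n IHn]; [exact: sg0 | rewrite mulrS; exact: sgD].
Qed.
Lemma sgMz x (n : int) : P x -> P (x *~ n).
Proof. by move=> Px; case: n => n; [|apply: sgN]; exact: sgMn. Qed.

End Subgroup.

Section SubgroupObject.
Variables (V : zmodType) (S : zmodClosed V).

Record subobj := Subobj { subobj_val :> V; _ : subobj_val \in S }.
HB.instance Definition _ := [isSub for subobj_val].
HB.instance Definition _ := [Choice of subobj by <:].
HB.instance Definition _ := [SubChoice_isSubZmodule of subobj by <:].

End SubgroupObject.

Definition pred_of_prop (V : Type) (P : V -> Prop) : {pred V} := fun x => `[<P x>].

Lemma zmodClosed_of_subgroup (V : zmodType) (P : V -> Prop) : subgroup P ->
  exists S : zmodClosed V, forall x, x \in S <-> P x.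
Proof.
move=> sP.
have cS : zmod_closed (pred_of_prop P).
  split; first by apply/asboolP; exact: sg0.
  by move=> x y /asboolP Px /asboolP Py; apply/asboolP; exact: sgB.
pose m := GRing.isZmodClosed.Build V (pred_of_prop P) cS.
exists (HB.pack_for (zmodClosed V) (pred_of_prop P) m) => x.
by split=> /asboolP.
Qed.

Lemma subgroup_object (V : zmodType) (P : V -> Prop) : subgroup P ->
  exists (K : zmodType) (k : {additive K -> V}),
    injective k /\ forall x, P x <-> exists y, k y = x.
Proof.
move=> /zmodClosed_of_subgroup[S SP].
exists (subobj S), val; split=> [|x]; first exact: val_inj.
rewrite -SP; split=> [xS | [y <-]]; first by exists (Subobj xS).
by case: y.
Qed.

Lemma quotient_object (V : zmodType) (P : V -> Prop) : subgroup P ->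
  exists (Q : zmodType) (q : {additive V -> Q}),
    onto q /\ forall x, q x = 0 <-> P x.
Proof.
move=> /zmodClosed_of_subgroup[S SP].
have [q qE] : exists q : {additive V -> Quotient.quot S},
    q =1 \pi_(Quotient.quot S)%qT.
  by apply: additive_of_fun => x y; exact: raddfB.
exists (Quotient.quot S), q; split=> [y|x]; first by exists (repr y); rewrite qE reprK.
rewrite -SP -[X in _ = X](raddf0 q) !qE -[X in X \in S]subr0 Quotient.idealrBE.
exact: (rwP eqP).
Qed.

(** * Telescopic groups *)

Definition tele_solvable (m : nat -> nat) (C : zmodType) : Prop :=
  forall a : nat -> C, exists c : nat -> C, forall n, c n = a n + c n.+1 *+ m n.

(** By linearity, the homogeneous case expresses uniqueness of solutions. Existence and uniqueness
    are kept apart because diagram chases use them on different groups. *)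
Definition tele_rigid (m : nat -> nat) (C : zmodType) : Prop :=
  forall c : nat -> C, (forall n, c n = c n.+1 *+ m n) -> forall n, c n = 0.

Definition telescopic m C := tele_solvable m C /\ tele_rigid m C.

Lemma tele_rigid_sub m (A B : zmodType) (f : {additive A -> B}) :
  injective f -> tele_rigid m B -> tele_rigid m A.
Proof.
move=> fI rB c cE n; apply: (inj_raddf0 fI); apply: (rB (f \o c)) => k /=.
by rewrite {1}cE raddfMn.
Qed.

Lemma tele_solvable_quo m (A B : zmodType) (f : {additive A -> B}) :
  onto f -> tele_solvable m A -> tele_solvable m B.
Proof.
move=> /choice[g gK] sA b; have [a aE] := sA (g \o b).
by exists (f \o a) => n /=; rewrite {1}aE raddfD raddfMn /= gK.
Qed.

(** A solution in A for data in K maps to a homogeneous solution in B, hence to 0, so it already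
    lies in K. *)
Lemma telescopic_kernel m (K A B : zmodType) (k : {additive K -> A})
    (f : {additive A -> B}) : injective k -> exact k f ->
  tele_solvable m A -> tele_rigid m A -> tele_rigid m B -> telescopic m K.
Proof.
move=> kI kf sA rA rB; split; last exact: (tele_rigid_sub kI rA).
move=> a; have [c cE] := sA (k \o a).
have /choice[c' c'E] : forall n, exists x, k x = c n.
  move=> n; apply/kf; move: n; apply: (rB (f \o c)) => n /=.
  by rewrite {1}cE raddfD raddfMn /= (kf (k (a n))).2 ?add0r //; exists (a n).
by exists c' => n; apply: kI; rewrite raddfD raddfMn !c'E.
Qed.

(** For rigidity, lift a homogeneous solution to B. Its defect comes from A, and solving there for
    the defect corrects the lift to a homogeneous solution in B, which is 0. *)
Lemma telescopic_cokernel m (A B Q : zmodType) (f : {additive A -> B})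
    (q : {additive B -> Q}) : onto q -> exact f q ->
  tele_solvable m A -> telescopic m B -> telescopic m Q.
Proof.
move=> qS fq sA [sB rB]; split; first exact: (tele_solvable_quo qS sB).
move=> c cE; have [b bE] := choice qS.
have /choice[a aE] : forall n, exists a, f a = b (c n) - b (c n.+1) *+ m n.
  by move=> n; apply/fq; rewrite raddfB raddfMn !bE {1}cE subrr.
have [a' a'E] := sA a.
have rb : forall n, b (c n) - f (a' n) = 0.
  apply: rB => n; rewrite {1}a'E raddfD raddfMn aE; zmod.
move=> n; rewrite -[c n]bE -[b _](subrK (f (a' n))) rb add0r.
by apply/fq; exists (a' n).
Qed.

(** Solve in F, lift to X, and absorb the defect of the lift by solving in C. *)
Lemma telescopic_extension m (F C : zmodType) (X : extension F C) :
  telescopic m C -> telescopic m F -> telescopic m X.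
Proof.
move=> [sC rC] [sF rF]; have ex := @ext_exact _ _ X; have iI := @ext_in_inj _ _ X.
split=> [a|c cE].
  have [c cE] := sF (ext_out X \o a).
  have /choice[e eE] : forall n, exists e, ext_out X e = c n.
    by move=> n; exact: ext_out_surj.
  have /choice[d dE] : forall n, exists d, ext_in X d = a n - (e n - e n.+1 *+ m n).
    move=> n; apply/ex; rewrite !raddfB raddfMn !eE {1}cE /=; zmod.
  have [x xE] := sC d; exists (fun n => e n + ext_in X (x n)) => n /=.
  rewrite {1}xE raddfD raddfMn dE; zmod.
have /choice[d dE] : forall n, exists d, ext_in X d = c n.
  by move=> n; apply/ex; move: n; apply: (rF (ext_out X \o c)) => n /=; rewrite {1}cE raddfMn.
move=> n; rewrite -dE (rC d) ?raddf0 // => k.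
by apply: iI; rewrite raddfMn !dE.
Qed.

Lemma product_groupMn I (A : I -> zmodType) (x : product_group A) n i :
  (x *+ n) i = x i *+ n.
Proof. by elim: n => [|n IHn]; rewrite ?mulr0n // !mulrS -IHn. Qed.

Lemma telescopic_product m I (A : I -> zmodType) :
  (forall i, telescopic m (A i)) -> telescopic m (product_group A).
Proof.
move=> tA; split=> [a|c cE n].
  pose c i := cid ((tA i).1 (a^~ i)).
  exists (fun n i => sval (c i) n) => n; apply: functional_extensionality_dep => i.
  transitivity (a n i + sval (c i) n.+1 *+ m n); last first.
    by rewrite -(product_groupMn (fun j => sval (c j) n.+1 : A j)).
  exact: (svalP (c i)).
apply: functional_extensionality_dep => i; rewrite -[RHS]/(0 : A i).
have [_ rA] := tA i; apply: (rA (fun n => c n i)) => k.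
by rewrite -product_groupMn -cE.
Qed.

(** Equivalently, the m n are positive and the inverses of their partial products generate the group
    of rationals. *)
Definition cofinal (m : nat -> nat) : Prop :=
  (forall n, 0 < m n)%N /\
  forall d, (0 < d)%N -> exists n, (d %| \prod_(i < n) m i)%N.

(** Quantifying over all cofinal sequences lets each argument choose its own: successive integers,
    [p * prime_to p n], or a shifted tail. *)
Definition telecomplete (C : zmodType) : Prop :=
  forall m, cofinal m -> telescopic m C.

Lemma cofinal_succ : cofinal succn.
Proof.
split=> // d d0; exists d; case: d d0 => // d _.
by rewrite big_ord_recr dvdn_mull.
Qed.

Lemma tele_iter m (C : zmodType) (c : nat -> C) n k :
  (forall n, c n = c n.+1 *+ m n) ->
  c n = c (n + k)%N *+ \prod_(n <= i < n + k) m i.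
Proof.
move=> cE; elim: k => [|k ->]; first by rewrite addn0 big_geq.
by rewrite {1}cE -mulrnA addnS big_nat_recr ?leq_addr //= mulnC.
Qed.

(** Dividing x inside D successively by 1, 2, 3, ... produces a homogeneous solution that starts at
    x. *)
Lemma divisible_telecomplete (C : zmodType) (D : C -> Prop) : telecomplete C ->
  (forall n x, (0 < n)%N -> D x -> exists2 y, D y & y *+ n = x) ->
  forall x, D x -> x = 0.
Proof.
move=> /(_ _ cofinal_succ)[_ rC] divD x Dx.
have /choice[g gP] : forall nx : nat * {x | D x}, exists y : {x | D x},
    sval y *+ nx.1.+1 = sval nx.2.
  by move=> [n [y Dy]]; have [//|z Dz zE] := divD n.+1 y _ Dy; exists (exist _ z Dz).
pose c := fix c n : {x | D x} := if n is k.+1 then g (k, c k) else exist _ x Dx.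
have := rC (fun n => sval (c n)); move/(_ _ 0%N); apply=> n /=.
by rewrite gP.
Qed.

(** * Rank-one groups and extensions *)

Lemma Ext1_zero_retraction (F C : zmodType) :
  Ext1_zero F C <-> forall X : extension F C,
    exists r : {additive X -> C}, forall c, r (ext_in X c) = c.
Proof.
split=> [sF X | sF X].
  have [h [_ hi _]] := sF X.
  have [|r rE] := @additive_of_fun X C (fun e => (h e).1); first by move=> x y; rewrite raddfB.
  by exists r => c; rewrite rE hi.
have [r rK] := sF X.
have [|h hE] := @additive_of_fun X (split_extension F C) (fun e => (r e, ext_out X e)).
  by move=> x y; rewrite !raddfB.
have hI : injective h.
  apply: raddf_inj0 => x; rewrite hE => -[rx0 /ext_exact[c cx]].
  by move: rx0; rewrite -cx rK => ->; rewrite raddf0.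
have hS : onto h.
  move=> [c x]; have [e <-] := @ext_out_surj _ _ X x.
  exists (e + ext_in X (c - r e)); rewrite hE (raddfD r) (raddfD (ext_out X)) rK.
  have -> : ext_out X (ext_in X (c - r e)) = 0 by apply/ext_exact; exists (c - r e).
  by rewrite addr0 addrC subrK.
have [g [hK gK]] := additive_inverse hI hS.
exists h; split=> [|c|e]; first by exists g.
  by rewrite hE rK; congr pair; apply/ext_exact; exists c.
by rewrite hE.
Qed.

(* Exhibits R as the union of the infinite cyclic groups generated by the e n. *)
Record chain (R : zmodType) (m : nat -> nat) (e : nat -> R) : Prop := Chain {
  chain_step : forall n, e n = e n.+1 *+ m n;
  chain_free : forall n (k : int), e n *~ k = 0 -> k = 0;
  chain_span : forall x, exists n (k : int), x = e n *~ k }.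

(** A homogeneous solution c defines a homomorphism from R sending [e n] to [c n]; freeness of each
    [e n] makes it well defined. *)
Lemma chain_rigid (R C : zmodType) m (e : nat -> R) :
  chain m e -> Hom_zero R C -> tele_rigid m C.
Proof.
move=> [eS e0 eR] hom0 c cS.
have up n k j : exists l : int, e n *~ k = e (n + j)%N *~ l /\ c n *~ k = c (n + j)%N *~ l.
  exists ((\prod_(n <= i < n + j) m i)%N%:Z * k).
  by rewrite !mulrzA -!pmulrn -(tele_iter n j eS) -(tele_iter n j cS).
have [||y [n [k [/esym/e0 -> ->]]]//|f fP] := @additive_of_graph R C
    (fun x y => exists n (k : int), x = e n *~ k /\ y = c n *~ k).
- by move=> x; have [n [k xE]] := eR x; exists (c n *~ k), n, k.
- move=> _ _ _ _ [n [k [-> ->]]] [n' [k' [-> ->]]].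
  have [l [-> ->]] := up n k n'; have [l' [-> ->]] := up n' k' n.
  by exists (n + n')%N, (l - l'); rewrite [(n' + n)%N]addnC !mulrzBr.
move=> n; have [i [k [xE yE]]] := fP (e n).
(* The graph may represent [e n] at another index i. At the common index i + n the coefficients
   agree by freeness, so [f (e n)] is [c n]. *)
have [l [eE cE]] := up i k n; have [l' [eE' cE']] := up n 1 i.
have l0 : l' - l = 0.
  by apply: (e0 (i + n)%N); rewrite mulrzBr -eE -xE addnC -eE' subrr.
rewrite -[c n]mulr1z cE' (subr0_eq l0) addnC -cE -yE; exact: hom0.
Qed.

(** Sequences modulo eventually zero ones: a group in which a divergent series has a value, namely
    the germ of its partial sums. *)
Lemma germ_object (C : zmodType) :
  exists (G : zmodType) (germ : {additive product_group (fun _ : nat => C) -> G}),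
    forall s, germ s = 0 <-> exists N, forall n, (N <= n)%N -> s n = 0.
Proof.
have [|G [germ [_ gP]]] := @quotient_object (product_group (fun _ : nat => C))
   (fun s => exists N, forall n, (N <= n)%N -> s n = 0); last by exists G, germ.
split=> [|x y [N xN] [N' yN']]; first by exists 0%N.
exists (maxn N N') => n; rewrite geq_max => /andP[/xN xn /yN' yn].
by rewrite -[LHS]/(x n - y n) xn yn subrr.
Qed.

(* The divergent sums w n = \sum_(k >= n) (m n ... m k.-1) a k make sense as
   germs at infinity of their partial sums; the extension of R by C generated
   by C and the w n splits exactly when the recurrence for a is solvable. *)
Lemma chain_solvable (R C : zmodType) m (e : nat -> R) :
  chain m e -> Ext1_zero R C -> tele_solvable m C.
Proof.
move=> [eS e0 eR] /Ext1_zero_retraction ext0 a.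
have [G [germ gP]] := germ_object C.
have germ_eq s t N : (forall n, (N <= n)%N -> s n = t n) -> germ s = germ t.
  move=> st; apply/eqP; rewrite -subr_eq0 -raddfB; apply/eqP/gP; exists N => n Nn.
  by rewrite -[LHS]/(s n - t n) st // subrr.
have [|kap kapE] := @additive_of_fun C G (fun c => germ (fun _ => c)).
  by move=> x y; rewrite -raddfB.
have kapI : injective kap.
  apply: raddf_inj0 => x; rewrite kapE => /gP[N]; exact.
(* [S j n] sums the first j terms of the series [w n]. In [w n] all series are cut at the same
   absolute index N, so the recurrence holds once N > n. *)
pose S := fix S j n : C := if j is i.+1 then a n + S i n.+1 *+ m n else 0.
pose w n := germ (fun N => S (N - n)%N n).
have wS n : w n = kap (a n) + w n.+1 *+ m n.
  rewrite kapE /w -raddfMn -raddfD; apply: (germ_eq _ _ n.+1) => N nN.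
  rewrite -[RHS]/(a n + (_ *+ m n) N) product_groupMn /=.
  by rewrite -(subnSK nN).
(* The middle group of the extension is generated in G x R by C and the pairs [(w n, e n)]; freeness
   of [e n] makes C the kernel of the second projection. *)
pose P (x : (G * R)%type) := exists n (k : int) c, x = (w n *~ k + kap c, e n *~ k).
have up n k c j : exists (l : int) d, (w n *~ k + kap c, e n *~ k) =
    (w (n + j)%N *~ l + kap d, e (n + j)%N *~ l).
  elim: j => [|j [l [d ->]]]; first by exists k, c; rewrite addn0.
  exists ((m (n + j)%N)%:Z * l), (d + a (n + j)%N *~ l).
  rewrite addnS wS eS raddfD raddfMz; congr pair; zmod.
have sP : subgroup P.
  split; first by exists 0%N, 0, 0; rewrite !mulr0z raddf0 addr0.
  move=> _ _ [n [k [c ->]]] [n' [k' [c' ->]]].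
  have [l [d ->]] := up n k c n'; have [l' [d' ->]] := up n' k' c' n.
  exists (n + n')%N, (l - l'), (d - d'); rewrite [(n' + n)%N]addnC raddfB.
  by apply: injective_projections; rewrite /=; zmod.
have [K [i [iI iP]]] := subgroup_object sP.
have /choice[u uE] : forall c, exists y, i y = (kap c, 0).
  by move=> c; apply/iP; exists 0%N, 0, c; rewrite !mulr0z add0r.
have [|inn innE] := @additive_of_fun C K u.
  by move=> x y; apply: iI; rewrite raddfB !uE raddfB /=; congr pair; rewrite subrr.
have [|out outE] := @additive_of_fun K R (fun y => (i y).2); first by move=> x y; rewrite raddfB.
have innI : injective inn.
  apply: raddf_inj0 => c; rewrite innE => /(congr1 i).
  by rewrite uE raddf0 => -[/(inj_raddf0 kapI)].
have outS : forall x, exists y, out y = x.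
  move=> x; have [n [k xE]] := eR x.
  have [y yE] : exists y, i y = (w n *~ k + kap 0, e n *~ k) by apply/iP; exists n, k, 0.
  by exists y; rewrite outE yE.
have ex : forall y, out y = 0 <-> exists c, inn c = y.
  move=> y; rewrite outE; split=> [y0|[c <-]]; last by rewrite innE uE.
  have [n [k [c yE]]] : P (i y) by apply/iP; exists y.
  exists c; apply: iI; rewrite innE uE yE; move: y0; rewrite yE /= => /e0 ->.
  by rewrite !mulr0z add0r.
have [r rK] := ext0 (Extension innI outS ex).
have /choice[y yE] : forall n, exists y, i y = (w n, e n).
  by move=> n; apply/iP; exists n, 1, 0; rewrite !mulr1z raddf0 addr0.
(* The pairs [(w n, e n)] satisfy the recurrence in the extension, and the retraction r carries it
   to C. *)
exists (fun n => r (y n)) => n; rewrite -[a n](rK) -raddfMn -raddfD; congr (r _).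
apply: iI; rewrite raddfD raddfMn !yE innE uE wS eS.
by apply: injective_projections; rewrite raddfD raddfMn //= add0r.
Qed.

(** * Flat groups *)

(** Z (x) F is F itself, so tensoring the injective multiplication by n on Z gives multiplication by
    n on F. *)
Lemma flat_torsion_free (F : zmodType) : flat F ->
  forall n (x : F), (0 < n)%N -> x *+ n = 0 -> x = 0.
Proof.
move=> flatF n x n0 xn0.
have tensor : is_tensor (fun (k : int) (x : F) => x *~ k).
  split=> [|W b [b1 b2]]; first by split=> [k y z|y k l]; zmod.
  have [h hE] := additive_of_fun (b1 1).
  exists h; split=> [k y | h' h'E].
    have [g gE] := additive_of_fun (b2 y).
    by rewrite raddfMz hE -gE -raddfMz gE -[1 *~ k]/(k%:~R) intz.
  by apply: additive_ext => y; rewrite hE -[y in RHS]mulr1z h'E.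
have [|f fE] := @additive_of_fun int int (fun k => k *+ n); first by move=> k l; rewrite mulrnBl.
have [|h hE] := @additive_of_fun F F (fun x => x *+ n); first by move=> y z; rewrite mulrnBl.
apply: (inj_raddf0 (flatF int int f F F _ _ h tensor tensor _ _)); last by rewrite hE.
- by move=> k y; rewrite fE hE; zmod.
- by apply: raddf_inj0 => k; rewrite fE => /eqP; rewrite mulrn_eq0 eqn0Ngt n0 => /eqP.
Qed.

(** Two elementary tensors can be written over a common z, so they form a subgroup. Factoring t
    through it, the uniqueness part of the universal property forces this subgroup to be all of
    T. *)
Lemma tensor_pure (A F T : zmodType) (t : A -> F -> T) : is_tensor t ->
    (forall x y : F, exists z (i j : int), x = z *~ i /\ y = z *~ j) ->
  forall u, exists a x, u = t a x.
Proof.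
move=> [[t1 t2] univ] cyc.
have tM a x (k : int) : t a (x *~ k) = t (a *~ k) x.
  have [f fE] := additive_of_fun (t1 a); have [g gE] := additive_of_fun (t2 x).
  by rewrite -fE raddfMz fE -gE -raddfMz gE.
have sP : subgroup (fun u => exists a x, u = t a x).
  split.
    by exists 0, 0; have [f fE] := additive_of_fun (t1 0); rewrite -fE raddf0.
  move=> _ _ [a [x ->]] [b [y ->]]; have [z [i [j [-> ->]]]] := cyc x y.
  by exists (a *~ i - b *~ j), z; rewrite !tM t2.
have [K [k [kI kP]]] := subgroup_object sP.
have /choice[b bE] : forall ax : A * F, exists y, k y = t ax.1 ax.2.
  by move=> ax; apply/kP; exists ax.1, ax.2.
have [|g [gE _]] := univ K (fun a x => b (a, x)).
  by split=> [a x y|x a c]; apply: kI; rewrite raddfB !bE /= ?t1 ?t2.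
have [h [hE hU]] := univ T t (conj t1 t2).
move=> u; apply/kP; exists (g u).
have [|kg kgE] := @additive_of_fun T T (k \o g); first by move=> x y /=; rewrite !raddfB.
rewrite -[LHS]/((k \o g) u) -kgE -(hU kg) => [|x y]; last by rewrite kgE /= gE bE.
have [|i iE] := @additive_of_fun T T idfun; first by [].
by rewrite (hU i) ?iE // => x y; rewrite iE.
Qed.

Lemma rat_locally_cyclic (x y : rat) : exists z (i j : int), x = z *~ i /\ y = z *~ j.
Proof.
exists ((denq x)%:~R^-1 / (denq y)%:~R), (numq x * denq y), (numq y * denq x).
rewrite -2!mulrzr !intrM -{1}[x]divq_num_den -{3}[y]divq_num_den.
have dx : (denq x)%:~R != 0 :> rat by rewrite intr_eq0 denq_neq0.
have dy : (denq y)%:~R != 0 :> rat by rewrite intr_eq0 denq_neq0.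
by split; field; rewrite dx dy.
Qed.

Lemma fact_mul_rat_int (x : rat) N : (`|denq x| <= N)%N ->
  x * N`!%:R = (numq (x * N`!%:R))%:~R.
Proof.
move=> dN.
have /dvdnP[k kE] : (`|denq x| %| N`!)%N.
  by apply: dvdn_fact; rewrite dN absz_gt0 denq_neq0.
have -> : x * N`!%:R = (numq x * k%:Z)%:~R.
  rewrite kE natrM -{1}[x]divq_num_den intrM -[X in _ * (_ * X)](_ : (denq x)%:~R = _).
    rewrite mulrACA mulVf ?mulr1 ?intr_eq0 ?denq_neq0 //.
  by rewrite -[in LHS](gez0_abs (denq_ge0 x)).
by rewrite numq_int.
Qed.

(* b (x) r is sent to the germ of the sequence (N! r) b, whose vanishing
   forces b (x) r = b (N! r) (x) 1/N! to vanish. *)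
Lemma rat_flat : flat rat.
Proof.
move=> A B f TA TB tA tB h tenA tenB hE fI; apply: raddf_inj0 => u.
have [a [x ->]] := tensor_pure tenA rat_locally_cyclic u; rewrite hE => tB0.
have [G [germ gP]] := germ_object B.
(* [numq] stands in for the integer N! r: once N is at least the denominator of r the product is
   integral, and earlier terms do not affect the germ. *)
pose b (y : B) (r : rat) := germ (fun N => y *~ numq (r * N`!%:R)).
have bB : biadditive b.
  split=> [y r s|r y z]; rewrite /b -raddfB; last first.
    by congr (germ _); apply/funext => N; exact: mulrzBl.
  apply/eqP; rewrite -subr_eq0 -raddfB; apply/eqP/gP.
  exists (maxn `|denq r| `|denq s|) => N; rewrite geq_max => /andP[rN sN].
  rewrite -[LHS]/(y *~ _ - (y *~ _ - y *~ _)).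
  rewrite mulrBl (fact_mul_rat_int rN) (fact_mul_rat_int sN) -rmorphB !numq_int; zmod.
have [g [gE _]] := tenB.2 G b bB.
have /gP[N0 N0P] : b (f a) x = 0 by rewrite -gE tB0 raddf0.
pose N := maxn N0 `|denq x|.
have := N0P N (leq_maxl _ _); rewrite -raddfMz => /(inj_raddf0 fI) a0.
have xE : x = N`!%:R^-1 *~ numq (x * N`!%:R).
  rewrite -mulrzl -fact_mul_rat_int ?leq_maxr // mulfK //.
  by rewrite pnatr_eq0 -lt0n fact_gt0.
have [[t1 t2] _] := tenA.
have [h1 h1E] := additive_of_fun (t1 a); have [h2 h2E] := additive_of_fun (t2 N`!%:R^-1).
by rewrite xE -h1E raddfMz h1E -h2E -raddfMz a0 raddf0.
Qed.

(** * Consequences of the Hom and Ext conditions *)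

Lemma chain_rat m : cofinal m ->
  chain m (fun n => (\prod_(i < n) m i)%:R^-1 : rat).
Proof.
move=> [m0 mcof].
have P0 n : (\prod_(i < n) m i)%:R != 0 :> rat.
  by rewrite pnatr_eq0 -lt0n prodn_gt0.
split=> [n|n k|x].
- rewrite big_ord_recr natrM invfM -[RHS]mulr_natr -mulrA mulVf ?mulr1 //.
  by rewrite pnatr_eq0 -lt0n.
- by move/eqP; rewrite -mulrzl mulf_eq0 invr_eq0 (negPf (P0 n)) orbF intr_eq0 => /eqP.
have [|n /dvdnP[k kE]] := mcof `|denq x|%N; first by rewrite absz_gt0 denq_neq0.
exists n, (numq x * k); rewrite -mulrzl intrM {1}[x](esym (divq_num_den x)).
have P0n := P0 n; move: P0n; rewrite kE natrM.
rewrite [X in k%:R * X](_ : _ = (denq x)%:~R :> rat); last first.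
  by rewrite -[in RHS](gez0_abs (denq_ge0 x)).
have d0 : (denq x)%:~R != 0 :> rat by rewrite intr_eq0 denq_neq0.
by rewrite mulf_eq0 negb_or => /andP[k0 _]; field; rewrite d0.
Qed.

Lemma reduced_Hom_rat (C : zmodType) : reduced C -> Hom_zero rat C.
Proof.
move=> redC f x; apply: (redC (pred_of_prop (fun y => exists x, f x = y))).
- split=> [|_ _ /asboolP[y <-] /asboolP[z <-]]; apply/asboolP.
    by exists 0; rewrite raddf0.
  by exists (y - z); rewrite raddfB.
- move=> n _ n0 /asboolP[y <-]; exists (f (y / n%:R)); first by apply/asboolP; exists (y / n%:R).
  by rewrite -raddfMn -(mulr_natr (y / n%:R)) divfK // pnatr_eq0 -lt0n.
- by apply/asboolP; exists x.
Qed.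

Lemma reduced_cotorsion_telecomplete (C : zmodType) :
  reduced_cotorsion C -> telecomplete C.
Proof.
move=> [redC cotC] m /chain_rat ch; split.
  exact: (chain_solvable ch (cotC _ rat_flat)).
exact: (chain_rigid ch (reduced_Hom_rat redC)).
Qed.

Lemma telecomplete_reduced (C : zmodType) : telecomplete C -> reduced C.
Proof.
move=> tC D cD divD x xD; apply: (divisible_telecomplete (D := fun x => x \in D) tC) => //.
Qed.

Section Contramodules.
Variable p : prime_number.
Let pos_p : (0 < val p)%N. Proof. exact/prime_gt0/valP. Qed.

Lemma chain_Zinv : exists e : nat -> Zinv p, chain (fun=> val p) e.
Proof.
have p0 : (val p)%:R != 0 :> rat by rewrite pnatr_eq0 -lt0n.
have inZ n : (val p)%:R ^- n \in Zinv_pred p.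
  by apply/asboolP; exists 1, n; rewrite mul1r.
have vMz (x : Zinv p) (k : int) : val (x *~ k) = val x *~ k by rewrite raddfMz.
have vMn (x : Zinv p) k : val (x *+ k) = val x *+ k by rewrite raddfMn.
exists (fun n => MkZinv (inZ n)); split=> [n|n k|x].
- apply: val_inj; rewrite vMn /= exprS invfM -[RHS]mulr_natl mulrA mulfV ?mul1r //.
- move=> /(congr1 val)/eqP; rewrite vMz /= -mulrzl mulf_eq0 invr_eq0.
  by rewrite expf_eq0 (negPf p0) andbF orbF intr_eq0 => /eqP.
- case: x => x xZ; have /asboolP[k [n xE]] := xZ; exists n, k.
  by apply: val_inj; rewrite vMz /= xE mulrzl.
Qed.

Lemma contramodule_telescopic (C : zmodType) :
  contramodule p C -> telescopic (fun=> val p) C.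
Proof.
move=> [hom0 ext0]; have [e ch] := chain_Zinv.
by split; [exact: (chain_solvable ch) | exact: (chain_rigid ch)].
Qed.

End Contramodules.

(** * Extending homomorphisms along p-pure embeddings *)

Section PureExtension.
Variables (p : nat) (E C P : zmodType).
Variables (i : {additive C -> E}) (q : {additive C -> P}).
Hypotheses (p_pr : prime p) (iI : injective i) (qS : onto q).
Hypothesis i_pure : forall e c, e *+ p = i c -> exists c', e = i c'.
Hypothesis tP : telescopic (fun=> p) P.

(* When q is the identity: G is disjoint from i C, and E / (G + i C) has no p-torsion. *)
Let good (G : E -> Prop) : Prop :=
  [/\ subgroup G, forall c, G (i c) <-> q c = 0
    & forall e g c, G g -> e *+ p = g + i c -> exists g' c', G g' /\ e = g' + i c'].

(** The alternative [set0] accommodates the empty chain, whose union is not a subgroup. *)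
Local Lemma good_bigcup (F : set (set E)) :
  (forall X, F X -> X = set0 \/ good X) -> total_on F subset ->
  (\bigcup_(X in F) X = set0 \/ good (\bigcup_(X in F) X))%classic.
Proof.
move=> Fgood Ftot.
have good_of X x : F X -> X x -> good X.
  by move=> FX Xx; case: (Fgood X FX) => // X0; move: Xx; rewrite X0.
have [[X0 [FX0 gX0]]|noX] := pselect (exists X, F X /\ good X); last first.
  left; apply/seteqP; split=> // x [X FX Xx]; case: noX.
  by exists X; split=> //; exact: good_of Xx.
right; have [[X00 _] X0i _] := gX0; split.
- split=> [|x y [X FX Xx] [Y FY Yy]]; first by exists X0.
  have [XY|YX] := Ftot X Y FX FY.
    by exists Y => //; have [sY _ _] := good_of Y y FY Yy; apply: (sgB sY) => //; exact: XY.
  by exists X => //; have [sX _ _] := good_of X x FX Xx; apply: (sgB sX) => //; exact: YX.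
- move=> c; split=> [[X FX Xc]|/X0i]; last by exists X0.
  by have [_ Xi _] := good_of X _ FX Xc; apply/Xi.
- move=> e g c [X FX Xg] eE; have [_ _ Xp] := good_of X g FX Xg.
  by have [g' [c' [Xg' ->]]] := Xp e g c Xg eE; exists g', c'; split=> //; exists X.
Qed.

Local Lemma good_maximal :
  exists G, good G /\ forall x, exists g c y, G g /\ x = g + i c + y *+ p.
Proof.
have [|G [Ggood Gmax]] := @Zorn_bigcup E (fun G => G = set0 \/ good G).
  by move=> F FP; exact: good_bigcup.
have {Ggood} : good G.
  (* The empty set is not maximal, being strictly contained in the good subgroup i (ker q). *)
  case: Ggood => // G0; pose K e := exists2 c, q c = 0 & i c = e.
  have Kgood : good K.
    split.
    - split=> [|_ _ [c c0 <-] [d d0 <-]]; first by exists 0; rewrite raddf0.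
      by exists (c - d); rewrite raddfB // c0 d0 subrr.
    - by move=> c; split=> [[d d0 /iI <-]|] //; exists c.
    - move=> e _ c [d d0 <-]; rewrite -raddfD => /i_pure[c' ->].
      by exists 0, c'; rewrite add0r; split=> //; exists 0; rewrite raddf0.
  case: (Gmax K); last by right.
  by rewrite G0; split=> // /(_ 0); apply; case: Kgood => -[].
move=> Ggood; have [sG Gi Gp] := Ggood; exists G; split=> // x.
apply: contrapT => xno.
(* Were k prime to p, a Bezout relation between k and p would put x itself in G + i C + p E. *)
have p_dvd k g c y : G g -> x *~ k = g + i c + y *+ p -> exists k', k = k' * p%:Z.
  move=> Gg kE; have [/dvdzP//|pk] := boolP (p%:Z %| k)%Z.
  have /coprimezP[[u v] /= uv] : coprimez k p.
    by rewrite coprimezE /= coprime_sym prime_coprime.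
  case: xno; exists (g *~ u), (c *~ u), (y *~ u + x *~ v); split; first exact: sgMz.
  transitivity ((x *~ k) *~ u + x *~ v *+ p).
    rewrite -[x in LHS]mulr1z -uv; zmod.
  rewrite kE raddfMz; zmod.
(* Descent on |k|: p divides k, and goodness of G cancels this p. *)
have x_free k g c : G g -> x *~ k = g + i c -> k = 0.
  have [n] := ubnP `|k|%N; elim: n k g c => // n IHn k g c kn Gg kE.
  have [//||k' k'E] := p_dvd k g c 0; first by rewrite kE mul0rn addr0.
  move: kE; rewrite k'E mulrzA -pmulrn => /(Gp _ _ _ Gg)[g' [c' [Gg' e'E]]].
  have [->|k'0] := eqVneq k' 0; first by rewrite mul0r.
  apply/eqP; rewrite mulf_eq0; apply/orP; left; apply/eqP; apply: (IHn _ _ _ _ Gg' e'E).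
  move: kn; rewrite ltnS; apply: leq_trans; rewrite k'E abszM.
  by rewrite ltn_Pmulr ?prime_gt1 // absz_gt0.
pose G' e := exists g (k : int), G g /\ e = g + x *~ k.
have G'x : G' x by exists 0, 1; split; [exact: sg0 | rewrite add0r].
have GG' : forall g, G g -> G' g by move=> g Gg; exists g, 0; rewrite addr0.
have G'good : good G'; last first.
  apply: (Gmax G'); last by right.
  split=> // /(_ x G'x) Gx; apply: xno; exists x, 0, 0; split=> //.
  rewrite raddf0; zmod.
split.
- split; first exact: GG' (sg0 sG).
  move=> _ _ [g [k [Gg ->]]] [g' [k' [Gg' ->]]]; exists (g - g'), (k - k').
  by split; [exact: sgB | zmod].
- move=> c; split=> [[g [k [Gg cE]]]|/Gi/GG'//].
  have k0 : k = 0 by apply: (x_free k (- g) c); [exact: sgN | rewrite cE; zmod].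
  by apply/Gi; rewrite cE k0 addr0.
- move=> e _ c [g [k [Gg ->]]] eE.
  have [||k' k'E] := p_dvd k (- g) (- c) e; first exact: sgN.
    rewrite raddfN eE; zmod.
  have [|g' [c' [Gg' e'E]]] := Gp (e - x *~ k') g c Gg.
    rewrite mulrnBl eE k'E; zmod.
  exists (g' + x *~ k'), c'; split; first by exists g', k'.
  rewrite -[e](subrK (x *~ k')) e'E; zmod.
Qed.

(** Modulo a maximal G, the group E contains P = C / ker q, with a quotient that is p-divisible and
    has no p-torsion. The elements infinitely p-divisible modulo G form a subgroup H: rigidity of P
    makes it meet P trivially, solvability makes it span E together with P. The extension r is the
    projection along H. *)
Lemma pure_extension : exists r : {additive E -> P}, forall c, r (i c) = q c.
Proof.
have [G [[sG Gi Gp] Gspan]] := good_maximal.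
have [sP rP] := tP.
pose H e := exists s : nat -> E, s 0%N = e /\ forall n, G (s n - s n.+1 *+ p).
have sH : subgroup H.
  split; first by exists (fun=> 0); split=> // n; rewrite mul0rn subrr; exact: sg0.
  move=> _ _ [s [<- sS]] [t [<- tS]]; exists (fun n => s n - t n); split=> // n.
  rewrite (_ : _ - _ = (s n - s n.+1 *+ p) - (t n - t n.+1 *+ p)); last zmod.
  exact: sgB.
have Hi c : H (i c) -> q c = 0.
  move=> [s [s0 sS]].
  (* Goodness keeps every successive quotient of i c in G + i C, and the images under q of the
     C-components form a homogeneous solution in P. The clause at n = 0 fixes its start at q c. *)
  have /choice[hc hcE] : forall n, exists hc,
      [/\ G hc.1, s n = hc.1 + i hc.2 & n = 0%N -> hc = (0, c)].
    elim=> [|n [[g d] [/= Gg sn _]]]; first by exists (0, c); rewrite add0r; split=> //; exact: sg0.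
    have [||g' [d' [Gg' s'E]]] := Gp (s n.+1) (g - (s n - s n.+1 *+ p)) d.
    - exact: sgB.
    - rewrite sn; zmod.
    by exists (g', d').
  have := rP (fun n => q (hc n).2); move/(_ _ 0%N).
  have [_ _ ->//] := hcE 0%N; apply=> n.
  apply/eqP; rewrite -subr_eq0 -raddfMn -raddfB; apply/eqP/Gi.
  have [Gn sn _] := hcE n; have [Gn' sn' _] := hcE n.+1.
  rewrite raddfB raddfMn (_ : _ - _ = (s n - s n.+1 *+ p) - ((hc n).1 - (hc n.+1).1 *+ p)).
    by apply: sgB => //; apply: sgB => //; exact: sgMn.
  rewrite sn sn'; zmod.
have Hspan e : exists c, H (e - i c).
  (* Iterate E = G + i C + p E starting from e. The solution in P whose data are the C-terms then
     corrects the iterates so that only terms in G remain. *)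
  have /choice[nx nxE] : forall y, exists z, exists2 a, G a.1 & y = z *+ p + a.1 + i a.2.
    move=> y; have [g [c [z [Gg ->]]]] := Gspan y; exists z, (g, c) => //=; zmod.
  pose y n := iter n nx e.
  have /choice[a aE] : forall n, exists a, G a.1 /\ y n = y n.+1 *+ p + a.1 + i a.2.
    by move=> n; have [a Ga yE] := nxE (y n); exists a.
  have [b bE] := sP (fun n => q (a n).2).
  have /choice[c cE] : forall n, exists c, q c = b n by move=> n; exact: qS.
  exists (c 0%N), (fun n => y n - i (c n)); split=> // n.
  have [Gn yE] := aE n.
  rewrite (_ : _ - _ = (a n).1 + i ((a n).2 - (c n - c n.+1 *+ p))).
    apply: sgD => //; apply/Gi; rewrite !(raddfB q) (raddfMn q) !cE {1}bE; zmod.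
  rewrite {1}yE !(raddfB i) (raddfMn i); zmod.
have [||x [c [H0 ->]]|r rE] := @additive_of_graph E P
  (fun e x => exists c, H (e - i c) /\ x = q c).
- by move=> e; have [c Hc] := Hspan e; exists (q c), c.
- move=> e e' _ _ [c [Hc ->]] [c' [Hc' ->]]; exists (c - c'); split; last by rewrite raddfB.
  rewrite (raddfB i) (_ : _ - _ = (e - i c) - (e' - i c')); first exact: sgB.
  zmod.
- by apply: Hi; rewrite -[i c]opprK -[- i c]sub0r; exact: sgN.
exists r => c; have [c' [Hc ->]] := rE (i c).
by apply/eqP; rewrite eq_sym -subr_eq0 -raddfB; apply/eqP/Hi; rewrite raddfB.
Qed.

End PureExtension.

(** * Primary components *)

(** On d-torsion elements, a Bezout coefficient w inverts multiplication by p. *)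
Lemma coprime_torsion_divisible (p d : nat) (C : zmodType) (x : C) :
  coprime p d -> x *+ d = 0 -> exists z : nat -> C, z 0%N = x /\ forall n, z n = z n.+1 *+ p.
Proof.
move=> pd xd0; have /coprimezP[[w v] /= wv] : coprimez p d by rewrite coprimezE.
exists (fun n => x *~ (w ^+ n)); split=> [|n]; first by rewrite expr0.
transitivity (x *~ (w ^+ n) *~ (w * p + v * d)); first by rewrite wv.
transitivity (x *~ (w ^+ n.+1) *+ p + (x *+ d) *~ (v * w ^+ n)).
  rewrite exprS; move: (w ^+ n) => a; zmod.
by rewrite xd0 mul0rz addr0.
Qed.

(** For p prime, the inverses of the partial products of this sequence generate Z_(p). *)
Definition prime_to (p n : nat) : nat := if coprime p n.+1 then n.+1 else 1%N.

(** That is, x is the image of 1 under a homomorphism Z_(p) -> C, given by its values on those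
    generators. Likewise [coprimary] describes the images of 1 under homomorphisms Z[1/p] -> C. *)
Definition primary (p : nat) (C : zmodType) (x : C) : Prop :=
  exists y : nat -> C, y 0%N = x /\ forall n, y n = y n.+1 *+ prime_to p n.

Definition coprimary (p : nat) (C : zmodType) (x : C) : Prop :=
  exists z : nat -> C, z 0%N = x /\ forall n, z n = z n.+1 *+ p.

Lemma tele_subgroup (m : nat -> nat) (C : zmodType) :
  subgroup (fun x : C => exists y : nat -> C, y 0%N = x /\ forall n, y n = y n.+1 *+ m n).
Proof.
split=> [|_ _ [y [<- yE]] [z [<- zE]]]; first by exists (fun=> 0); split=> // n; rewrite mul0rn.
by exists (fun n => y n - z n); split=> // n; rewrite yE zE; zmod.
Qed.

Lemma primary_subgroup p C : subgroup (@primary p C). Proof. exact: tele_subgroup. Qed.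
Lemma coprimary_subgroup p C : subgroup (@coprimary p C). Proof. exact: tele_subgroup. Qed.

Lemma coprime_prime_to p n : coprime p (prime_to p n).
Proof. by rewrite /prime_to; case: ifP => // _; rewrite coprimen1. Qed.

Section PrimaryDecomposition.
Variable p : nat.
Hypothesis p_pr : prime p.
Let T n := (\prod_(i < n) prime_to p i)%N.

Local Lemma coprime_T n : coprime p (T n).
Proof.
elim: n => [|n IHn]; first by rewrite /T big_ord0 coprimen1.
by rewrite /T big_ord_recr coprimeMr IHn coprime_prime_to.
Qed.

Lemma cofinal_prime_to : cofinal (fun n => p * prime_to p n)%N.
Proof.
split=> [n|d d0]; first by rewrite muln_gt0 prime_gt0 //= /prime_to; case: ifP.
have [k pk dE] := pfactor_coprime p_pr d0.
have k0 : (0 < k)%N by move: d0; rewrite dE muln_gt0 => /andP[].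
(* Long enough both for the power of p in d and for index k - 1, where the factor [prime_to] equals
   k. *)
exists (logn p d + k)%N; rewrite [X in (X %| _)%N]dE mulnC big_split /=.
rewrite prod_nat_const card_ord dvdn_mul //; first by rewrite dvdn_exp2l ?leq_addr.
have kn : (k.-1 < logn p d + k)%N by rewrite (leq_trans _ (leq_addl _ k)) // prednK.
by rewrite (bigD1 (Ordinal kn)) //= dvdn_mulr // /prime_to prednK // pk.
Qed.

(* In Z_(p) (+) Z[1/p], the pairs (v n / T n, u n / p ^ n) lift the generators
   1 / (p ^ n * T n) of Q along (x, y) |-> x + y, and k n is the defect in the
   kernel Z of this map. *)
Local Lemma bezout_chain : exists u v k : nat -> int, forall n,
  [/\ u n * (T n)%:Z + v n * (p ^ n)%N%:Z = 1,
      k n * (T n)%:Z = v n - p%:Z * v n.+1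
    & k n * (p ^ n)%N%:Z = (prime_to p n)%:Z * u n.+1 - u n].
Proof.
have /choice[w wE] : forall n, exists w : int * int,
    w.1 * (T n)%:Z + w.2 * (p ^ n)%N%:Z = 1.
  by move=> n; apply/coprimezP; rewrite coprimezE coprimeXr // coprime_sym coprime_T.
exists (fun n => (w n).1), (fun n => (w n).2).
(* Weighting the two required equations for k n by the Bezout coefficients u n and v n and adding
   gives this value. *)
exists (fun n => (w n).1 * ((w n).2 - p%:Z * (w n.+1).2)
               + (w n).2 * ((prime_to p n)%:Z * (w n.+1).1 - (w n).1)) => n.
have wn := wE n; have := wE n.+1.
have -> : T n.+1 = (T n * prime_to p n)%N by rewrite /T big_ord_recr.
rewrite expnS !PoszM; move: wn.
move: (w n) (w n.+1) => [u v] [u' v'] /=.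
move: ((T n)%:Z) ((p ^ n)%N%:Z) ((prime_to p n)%:Z) (p%:Z) => a b t q e e'.
split=> //.
- have : (v - q * v') * (u * a + v * b - 1)
      + v * ((u' * (a * t) + v' * (q * b)) - (u * a + v * b)) = 0.
    by rewrite e e'; ring.
  by move=> h; apply/eqP; rewrite -subr_eq0 -[X in _ == X]h; apply/eqP; ring.
- have : (t * u' - u) * (u * a + v * b - 1)
      + u * ((u * a + v * b) - (u' * (a * t) + v' * (q * b))) = 0.
    by rewrite e e'; ring.
  by move=> h; apply/eqP; rewrite -subr_eq0 -[X in _ == X]h; apply/eqP; ring.
Qed.

Variable C : zmodType.
Hypothesis tC : telecomplete C.

(** Homomorphisms from Z_(p) and Z[1/p] that both send 1 to x agree on Z, hence glue to one from Q;
    its values on the generators form a homogeneous solution. *)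
Lemma primary_coprimary0 (x : C) : primary p x -> coprimary p x -> x = 0.
Proof.
move=> [y [y0 yS]] [z [z0 zS]]; have [u [v [k uvk]]] := bezout_chain.
have yT n : x = y n *+ T n.
  elim: n => [|n ->]; first by rewrite /T big_ord0 mulr1n.
  by rewrite /T big_ord_recr /= mulnC mulrnA -yS.
have zP n : x = z n *+ p ^ n.
  by elim: n => [|n ->]; [rewrite expn0 mulr1n | rewrite expnS mulrnA -zS].
have [_ rC] := tC cofinal_prime_to.
have := rC (fun n => z n *~ u n + y n *~ v n); move/(_ _ 0%N).
have [+ _ _] := uvk 0%N; rewrite /T big_ord0 expn0 !mulr1 y0 z0 -mulrzDr => ->.
rewrite mulr1z; apply=> n; have [_ kT kP] := uvk n.
apply/eqP; rewrite -subr_eq0; apply/eqP.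
transitivity (z n *~ (u n - (prime_to p n)%:Z * u n.+1) + y n *~ (v n - p%:Z * v n.+1)).
  rewrite {1 2}zS {1 2}yS; zmod.
rewrite -kT -opprB -kP.
transitivity ((y n *+ T n - z n *+ p ^ n) *~ k n); first zmod.
by rewrite -yT -zP subrr mul0rz.
Qed.

(** Solvability extends the map 1 |-> x from the kernel Z to all of Z_(p) (+) Z[1/p], with [c n] the
    value at the lift of the n-th generator of Q. Up to sign, y and z are the values at the two
    units. *)
Lemma primary_coprimary_span (x : C) :
  exists y z, [/\ primary p y, coprimary p z & x = y + z].
Proof.
have [u [v [k uvk]]] := bezout_chain; have [sC _] := tC cofinal_prime_to.
have [c cE] := sC (fun n => x *~ k n).
pose y n := c n *+ p ^ n + x *~ u n; pose z n := x *~ v n - c n *+ T n.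
exists (y 0%N), (z 0%N); split.
- exists y; split=> // n; have [_ _ kP] := uvk n.
  apply/eqP; rewrite -subr_eq0 /y {1}cE expnS; apply/eqP.
  transitivity (x *~ (k n * (p ^ n)%N%:Z - ((prime_to p n)%:Z * u n.+1 - u n))); first zmod.
  by rewrite kP subrr mulr0z.
- exists z; split=> // n; have [_ kT _] := uvk n.
  apply/eqP; rewrite -subr_eq0 /z {1}cE /T big_ord_recr /= -/(T n); apply/eqP.
  transitivity (x *~ ((v n - p%:Z * v n.+1) - k n * (T n)%:Z)); first zmod.
  by rewrite kT subrr mulr0z.
have [uv0 _ _] := uvk 0%N; rewrite -[x in LHS]mulr1z -uv0 /y /z /T big_ord0 expn0; zmod.
Qed.

Lemma primary_torsion_free d (x : C) : coprime p d -> primary p x -> x *+ d = 0 -> x = 0.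
Proof.
by move=> pd Ax /(coprime_torsion_divisible pd); exact: primary_coprimary0.
Qed.

Lemma primary_divisible d (x : C) : (0 < d)%N -> coprime p d -> primary p x ->
  exists2 y, primary p y & y *+ d = x.
Proof.
move=> d0 pd Ax; have [w [w0 wS]] := Ax.
have xd : exists x', x' *+ d = x.
  (* As d is prime to p, the factor of index d - 1 in [T d] is d itself. *)
  exists (w d *+ T d.-1).
  have wT n : x = w n *+ T n.
    elim: n => [|n ->]; first by rewrite /T big_ord0 mulr1n.
    by rewrite /T big_ord_recr /= mulnC mulrnA -wS.
  rewrite (wT d); case: d d0 pd {Ax} => // d _ pd.
  by rewrite -mulrnA /T big_ord_recr /= /prime_to pd.
(* The quotient x' may fail to be primary. Its primary part y serves too: the error z d is
   coprimary, and also primary as a difference of primary elements. *)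
have [x' x'd] := xd; have [y [z [Ay Bz x'E]]] := primary_coprimary_span x'.
exists y => //; apply/eqP; rewrite -subr_eq0; apply/eqP; apply: primary_coprimary0.
  by apply: (sgB (primary_subgroup p C)) => //; exact: (sgMn (primary_subgroup p C)).
rewrite (_ : _ - _ = - (z *+ d)); last by rewrite -x'd x'E; zmod.
by apply: (sgN (coprimary_subgroup p C)); exact: (sgMn (coprimary_subgroup p C)).
Qed.

Lemma primary_coprimary q (x : C) : (0 < q)%N -> coprime p q -> primary p x -> coprimary q x.
Proof.
move=> q0 pq Ax.
have /choice[g gE] : forall y : {x : C | primary p x},
    exists z : {x : C | primary p x}, sval z *+ q = sval y.
  by move=> [y Ay]; have [z Az zE] := primary_divisible q0 pq Ay; exists (exist _ z Az).
by exists (fun n => sval (iter n g (exist _ x Ax))); split=> // n; rewrite /= gE.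
Qed.

Lemma primary_object : exists (K : zmodType) (k : {additive K -> C}) (pi : {additive C -> K}),
  [/\ cancel k pi, forall y, primary p (k y), forall x, primary p x -> k (pi x) = x,
      forall x, coprimary p x -> pi x = 0 & forall x, coprimary p (x - k (pi x))].
Proof.
have sA := primary_subgroup p C; have sB := coprimary_subgroup p C.
have [K [k [kI kP]]] := subgroup_object sA.
have kA y : primary p (k y) by apply/kP; exists y.
have [|x x' y y' h h'|y|pi piB] := @additive_of_graph C K (fun x y => coprimary p (x - k y)).
- move=> x; have [_ [z [/kP[y <-] Bz ->]]] := primary_coprimary_span x.
  by exists y; rewrite addrC addKr.
- rewrite (raddfB k) (_ : _ - _ = (x - k y) - (x' - k y')); last zmod.
  exact: (sgB sB).
- rewrite sub0r => /(sgN sB); rewrite opprK => By; apply: (inj_raddf0 kI).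
  exact: primary_coprimary0.
have kpi x : primary p x -> k (pi x) = x.
  move=> Ax; apply/eqP; rewrite eq_sym -subr_eq0; apply/eqP/primary_coprimary0 => //.
  exact: (sgB sA).
exists K, k, pi; split=> // [y|x Bx]; first exact/kI/kpi.
apply: (inj_raddf0 kI); apply: primary_coprimary0 => //.
rewrite (_ : k _ = x - (x - k (pi x))); last zmod.
exact: (sgB sB).
Qed.

Lemma primary_telescopic (K : zmodType) (k : {additive K -> C}) (pi : {additive C -> K}) :
  cancel k pi -> (forall y, primary p (k y)) -> telescopic (fun=> p) K.
Proof.
move=> kK kA; split=> [a|c cE n]; last first.
  apply: (inj_raddf0 (can_inj kK)); apply: primary_coprimary0 => //.
  exists (fun i => k (c (n + i)%N)); rewrite addn0; split=> // i.
  by rewrite cE raddfMn addnS.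
(* Dividing the data by [T n] leads to the recurrence for [p * prime_to p n]; multiplying its
   solution back by [T n] solves the one for p. *)
have /choice[b bE] : forall n, exists b, b *+ T n = k (a n).
  move=> n; have [|b _ bE] := primary_divisible _ (coprime_T n) (kA (a n)); last by exists b.
  by rewrite prodn_gt0 // => i; rewrite /prime_to; case: ifP.
have [sC _] := tC cofinal_prime_to; have [d dE] := sC b.
exists (fun n => pi (d n) *+ T n) => n; rewrite {1}dE raddfD raddfMn mulrnDl.
rewrite -(raddfMn pi (T n) (b n)) bE kK; congr (_ + _).
by rewrite /T big_ord_recr /= -!mulrnA; congr (_ *+ _); ring.
Qed.

End PrimaryDecomposition.

(** * Decomposition into contramodules *)

Lemma cofinal_shift N : cofinal (fun n => (n + N).+1).
Proof.
split=> // d d0; pose j := (d * N.+1 - N.+1)%N.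
have dj : (d * N.+1 = (j + N).+1)%N by rewrite -addnS subnK // leq_pmull.
by exists j.+1; rewrite big_ord_recr /= dvdn_mull // -dj dvdn_mulr.
Qed.

(** The elements coprimary at every prime form a set divisible by each prime, hence by each positive
    integer. *)
Lemma tele_prod_injective (C : zmodType) : telecomplete C ->
  forall x : C, (forall p, prime p -> coprimary p x) -> x = 0.
Proof.
move=> tC; pose D (x : C) := forall p, prime p -> coprimary p x.
have Dprime p x : prime p -> D x -> exists2 z, D z & z *+ p = x.
  move=> pp Dx; have [z [z0 zE]] := Dx p pp.
  exists (z 1%N); last by rewrite -zE.
  move=> q qp; have [->|neq_qp] := eqVneq q p.
    by exists (fun n => z n.+1); split=> // n; exact: zE.
  (* For q different from p, the q-primary part a of [z 1] vanishes: p a is the q-primary part of x,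
     hence 0, and q-primary elements have no p-torsion. *)
  have [a [b [Aa Bb zab]]] := primary_coprimary_span qp tC (z 1%N).
  have sA := primary_subgroup q C; have sB := coprimary_subgroup q C.
  rewrite zab (_ : a = 0) ?add0r //.
  apply: (primary_torsion_free qp tC (d := p)) => //.
    by rewrite prime_coprime // dvdn_prime2.
  apply: (primary_coprimary0 qp tC); first exact: sgMn.
  rewrite (_ : a *+ p = x - b *+ p); last by rewrite -z0 zE zab; zmod.
  by apply: (sgB sB); [exact: Dx | exact: sgMn].
apply: (divisible_telecomplete (D := D) tC) => n; have [k] := ubnP n.
elim: k n => // k IHk n nk x n0 Dx.
have [n1|n_neq1] := eqVneq n 1%N; first by exists x; rewrite ?n1.
have pn : prime (pdiv n) by rewrite pdiv_prime // ltn_neqAle eq_sym n_neq1.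
have [z Dz zx] := Dprime _ _ pn Dx.
have nE := divnK (pdiv_dvd n).
have m0 : (0 < n %/ pdiv n)%N by rewrite divn_gt0 ?pdiv_gt0 // pdiv_leq.
have [|y Dy yz] := IHk (n %/ pdiv n)%N _ z m0 Dz.
  exact: leq_trans (ltn_Pdiv (prime_gt1 pn) n0) nk.
by exists y => //; rewrite -nE mulrnA yz.
Qed.


(* The n-th digit of x is y_p divided by n! when n + 1 = p is prime, and 0 otherwise. *)
Lemma tele_prod_surjective (C : zmodType) (K : prime_number -> zmodType)
    (k : forall p, {additive K p -> C}) (pi : forall p, {additive C -> K p}) :
    telecomplete C -> (forall p, cancel (k p) (pi p)) ->
    (forall p y, primary (val p) (k p y)) ->
    (forall p x, primary (val p) x -> k p (pi p x) = x) ->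
    (forall p x, coprimary (val p) x -> pi p x = 0) ->
  forall y : (forall p, K p), exists x, forall p, pi p x = y p.
Proof.
move=> tC kK kA piA piB y.
have /choice[a aP] : forall n, exists a : C,
    (forall p, val p = n.+1 -> primary (val p) a /\ a *+ n`! = k p (y p))
    /\ (~~ prime n.+1 -> a = 0).
  move=> n; case: (boolP (prime n.+1)) => [np|nnp]; last first.
    by exists 0; split=> // p pn; move: (valP p) nnp; rewrite pn => ->.
  pose P : prime_number := exist _ n.+1 np.
  have [||a Aa aE] := primary_divisible np tC (d := n`!) _ _ (kA P (y P)).
  - exact: fact_gt0.
  (* By Wilson's theorem n + 1 divides n! + 1, so it cannot divide n!. *)
  - rewrite prime_coprime //; apply/negP => pf.
    have := np; rewrite Wilson ?prime_gt1 //= -(addn1 n`!) dvdn_addr // dvdn1.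
    by move=> /eqP n0; have := prime_gt1 np; rewrite n0.
  exists a; split=> // p pn.
  by have -> : p = P by exact: val_inj.
have [sC _] := tC _ cofinal_succ; have [c cE] := sC a.
exists (c 0%N) => p.
have pia n : n.+1 <> val p -> pi p (a n) = 0.
  have [aPn a0] := aP n; move=> np; have [npr|/a0->] := boolP (prime n.+1); last first.
    by rewrite raddf0.
  apply: piB; have [|Aa _] := aPn (exist _ n.+1 npr); first by [].
  apply: (primary_coprimary npr tC) => //; first exact/prime_gt0/valP.
  by rewrite prime_coprime // dvdn_prime2 ?(valP p) //; apply/eqP.
have step n : n.+1 <> val p -> pi p (c n) = pi p (c n.+1) *+ n.+1.
  by move=> /pia an; rewrite {1}cE raddfD an add0r raddfMn.
have p0 : (0 < val p)%N by exact/prime_gt0/valP.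
(* From index p on, [pi p] kills every digit, so the images of the tail form a homogeneous solution.
   Only the digit at index p - 1 survives, and it enters with the factor (p - 1)!. *)
have cp0 : pi p (c (val p)) = 0.
  have [_ rC] := tC _ (cofinal_shift (val p)).
  have rK := tele_rigid_sub (can_inj (kK p)) rC.
  apply: (rK (fun n => pi p (c (n + val p)%N)) _ 0%N) => n.
  by rewrite step // => e; have := leq_addl n (val p); rewrite -{1}e ltnn.
have c0 n : (n < val p)%N -> pi p (c 0%N) = pi p (c n) *+ n`!.
  elim: n => [|n IHn] np; first by rewrite fact0 mulr1n.
  rewrite IHn 1?ltnW // step; first by rewrite -mulrnA factS.
  by move=> e; rewrite e ltnn in np.
rewrite (c0 (val p).-1) ?prednK // {1}cE prednK // raddfD raddfMn cp0 mul0rn addr0.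
have [ap _] := aP (val p).-1; have [|_ aE] := ap p; first by rewrite prednK.
by rewrite -raddfMn aE kK.
Qed.

Lemma primary_product (C : zmodType) : telecomplete C ->
  exists (K : prime_number -> zmodType) (pi : forall p, {additive C -> K p})
    (f : {additive C -> product_group K}),
    [/\ forall p, telescopic (fun=> val p) (K p), forall p, onto (pi p),
        forall x p, f x p = pi p x & injective f /\ onto f].
Proof.
move=> tC.
pose ob (p : prime_number) := cid (primary_object (valP p) tC).
pose ob' p := cid (svalP (ob p)); pose ob'' p := cid (svalP (ob' p)).
pose K p := sval (ob p).
pose k p : {additive K p -> C} := sval (ob' p).
pose pi p : {additive C -> K p} := sval (ob'' p).
have piP p : [/\ cancel (k p) (pi p), forall y, primary (val p) (k p y),
    forall x, primary (val p) x -> k p (pi p x) = x,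
    forall x, coprimary (val p) x -> pi p x = 0
    & forall x, coprimary (val p) (x - k p (pi p x))] := svalP (ob'' p).
have [|f fE] := @additive_of_fun C (product_group (fun p => K p)) (fun x p => pi p x).
  by move=> x y; apply: functional_extensionality_dep => p; exact: raddfB.
exists (fun p => K p), pi, f; split.
- by move=> p; have [kK kA _ _ _] := piP p; exact: (primary_telescopic (valP p) tC kK kA).
- by move=> p y; have [kK _ _ _ _] := piP p; exists (k p y); exact: kK.
- by move=> x p; rewrite fE.
split.
  apply: raddf_inj0 => x fx0; apply: (tele_prod_injective tC) => p pp.
  pose P : prime_number := exist _ p pp; have [_ _ _ _ B] := piP P.
  have pix0 : pi P x = 0 by rewrite -[LHS](congr1 (fun s => s P) (fE x)) fx0.
  by have := B x; rewrite pix0 raddf0 subr0.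
move=> y; have [||||x xE] := @tele_prod_surjective C K k pi tC _ _ _ _ y.
- by move=> p; have [] := piP p.
- by move=> p; have [] := piP p.
- by move=> p; have [] := piP p.
- by move=> p; have [] := piP p.
by exists x; rewrite fE; exact: functional_extensionality_dep.
Qed.

(** * Recurrence criteria for reduced cotorsion groups and for contramodules *)

Lemma extension_pure (F C : zmodType) (X : extension F C) n :
  (forall x : F, x *+ n = 0 -> x = 0) ->
  forall (e : X) c, e *+ n = ext_in X c -> exists c', e = ext_in X c'.
Proof.
move=> Fn e c ec; have [|c' <-] := (ext_exact e).1; last by exists c'.
by apply: Fn; rewrite -raddfMn ec; apply/ext_exact; exists c.
Qed.

(** Each projection to a primary component extends over the given extension; together these
    extensions form a retraction, as C is the product of its components. *)
Lemma telecomplete_reduced_cotorsion (C : zmodType) :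
  telecomplete C -> reduced_cotorsion C.
Proof.
move=> tC; split; first exact: telecomplete_reduced.
move=> F /flat_torsion_free Ftf; apply/Ext1_zero_retraction => X.
have [K [pi [f [tK piS fE [fI fS]]]]] := primary_product tC.
have rP (p : prime_number) : exists r : {additive X -> K p}, forall c, r (ext_in X c) = pi p c.
  apply: (pure_extension (valP p) (@ext_in_inj _ _ X) (piS p) _ (tK p)).
  by apply: extension_pure => x; apply: Ftf; exact/prime_gt0/valP.
pose r p := sval (cid (rP p)).
have [|s sE] := @additive_of_fun X (product_group K) (fun e p => r p e).
  by move=> x y; apply: functional_extensionality_dep => p; exact: raddfB.
have [g [fK _]] := additive_inverse fI fS.
exists (g \o s) => c /=; rewrite -[RHS]fK; congr (g _); rewrite sE.
by apply: functional_extensionality_dep => p; rewrite fE; exact: (svalP (cid (rP p))).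
Qed.

Lemma reduced_cotorsionP (C : zmodType) : reduced_cotorsion C <-> telecomplete C.
Proof.
by split; [exact: reduced_cotorsion_telecomplete | exact: telecomplete_reduced_cotorsion].
Qed.

Lemma telescopic_prime_Ext (p : nat) (F C : zmodType) : prime p ->
  telescopic (fun=> p) C -> (forall x : F, x *+ p = 0 -> x = 0) -> Ext1_zero F C.
Proof.
move=> pp tC Fp; apply/Ext1_zero_retraction => X.
have [c|r rE] := @pure_extension p X C C (ext_in X) (additive_id C) pp
  (@ext_in_inj _ _ X) _ (extension_pure Fp) tC; first by exists c.
by exists r.
Qed.

Lemma contramoduleP (p : prime_number) (C : zmodType) :
  contramodule p C <-> telescopic (fun=> val p) C.
Proof.
split; first exact: contramodule_telescopic.
move=> tC; split.
  move=> f x; have [e [eS _ eR]] := chain_Zinv p; have [n [k ->]] := eR x.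
  have [_ rC] := tC; rewrite raddfMz (_ : f (e n) = 0) ?mul0rz //.
  by apply: (rC (f \o e)) => i /=; rewrite {1}eS raddfMn.
apply: (telescopic_prime_Ext (valP p) tC) => x xp; apply: val_inj; apply/eqP.
have := congr1 val xp; rewrite raddfMn /= => /eqP.
by rewrite mulrn_eq0 eqn0Ngt prime_gt0 ?(valP p).
Qed.

Lemma contramodule_reduced_cotorsion (p : prime_number) (C : zmodType) :
  contramodule p C -> reduced_cotorsion C.
Proof.
move=> /contramoduleP tC; have p0 : (0 < val p)%N by exact/prime_gt0/valP.
split=> [D _ divD x xD | F /flat_torsion_free Ftf].
  have /choice[g gE] : forall y : {y : C | y \in D}, exists z : {y : C | y \in D},
      sval z *+ val p = sval y.
    by move=> [y yD]; have [z zD zE] := divD _ _ p0 yD; exists (exist _ z zD).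
  have [_ rC] := tC; apply: (rC (fun n => sval (iter n g (exist _ x xD))) _ 0%N) => n /=.
  by rewrite gE.
by apply: (telescopic_prime_Ext (valP p) tC) => x; exact: Ftf.
Qed.

Lemma telescopic_prime_rigid_hom (p : nat) (A C : zmodType) (f : {additive A -> C}) x :
  tele_rigid (fun=> p) C -> coprimary p x -> f x = 0.
Proof.
move=> rC [z [<- zE]]; apply: (rC (f \o z) _ 0%N) => n /=.
by rewrite {1}zE raddfMn.
Qed.

Lemma telescopic_prime_coprimary (p q : nat) (C : zmodType) : prime p -> prime q -> p != q ->
  telescopic (fun=> q) C -> forall x : C, coprimary p x.
Proof.
move=> pp qq pq [sC rC].
have qp : coprime q p by rewrite prime_coprime // dvdn_prime2 // eq_sym.
have /coprimezP[[v u] /= uv] : coprimez q p by rewrite coprimezE.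
have div x : exists y : C, y *+ p = x.
  (* With v q + u p = 1, the series sum of u v^n q^n represents u / (1 - v q) = 1 / p; applied to x,
     it is the solution [c 0]. *)
  have [c cE] := sC (fun n => x *~ (v ^+ n * u)); exists (c 0%N).
  have := rC (fun n => c n *+ p - x *~ v ^+ n); move/(_ _ 0%N).
  rewrite expr0 mulr1z => h; apply/eqP; rewrite -subr_eq0; apply/eqP/h => n.
  rewrite {1}cE exprS; move: (v ^+ n) => a.
  apply/eqP; rewrite -subr_eq0; apply/eqP.
  transitivity ((x *~ (v * q + u * p) - x) *~ a); first zmod.
  by rewrite uv mulr1z subrr mul0rz.
move=> x; have [g gE] := choice div.
by exists (fun n => iter n g x); split=> // n; rewrite gE.
Qed.

(** * Subcategories of abelian groups *)

Local Open Scope cat_scope.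

Definition full (C D : category) (F : functor C D) : Prop :=
  forall (X Y : C) (g : Hom (F X) (F Y)), exists f : Hom X Y, fmap F f = g.

Definition faithful (C D : category) (F : functor C D) : Prop :=
  forall (X Y : C) (f g : Hom X Y), fmap F f = fmap F g -> f = g.

Definition essentially_surjective (C D : category) (F : functor C D) : Prop :=
  forall Y : D, exists (X : C) (h : Hom (F X) Y), is_iso h.

Lemma full_faithful_equivalence (C D : category) (F : functor C D) :
  full F -> faithful F -> essentially_surjective F -> is_equivalence F.
Proof.
move=> Ffull Ffaith Fess.
pose G0 Y := sval (cid (Fess Y)).
pose h Y : Hom (F (G0 Y)) Y := sval (cid (svalP (cid (Fess Y)))).
have hiso Y : is_iso (h Y) := svalP (cid (svalP (cid (Fess Y)))).
pose h' Y := sval (cid (hiso Y)).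
have h'P Y : h' Y ∘ h Y = idm _ /\ h Y ∘ h' Y = idm Y := svalP (cid (hiso Y)).
pose G1 (X Y : D) (f : Hom X Y) := sval (cid (Ffull _ _ (h' Y ∘ f ∘ h X))).
have G1E (X Y : D) (f : Hom X Y) : fmap F (G1 _ _ f) = h' Y ∘ f ∘ h X.
  exact: svalP (cid (Ffull _ _ (h' Y ∘ f ∘ h X))).
have G11 X : G1 _ _ (idm X) = idm (G0 X).
  by apply: Ffaith; rewrite G1E fmap1 compm1; have [] := h'P X.
have G1M (X Y Z : D) (g : Hom Y Z) (f : Hom X Y) : G1 _ _ (g ∘ f) = G1 _ _ g ∘ G1 _ _ f.
  apply: Ffaith; rewrite fmapM !G1E -!compA; congr (_ ∘ (_ ∘ _)).
  by rewrite [h Y ∘ _]compA (h'P Y).2 comp1m.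
exists (Functor G11 G1M); split; last first.
  exists h; split=> [Y | X Y f] /=; first by exists (h' Y).
  by rewrite G1E !compA (h'P Y).2 comp1m.
pose eta X := sval (cid (Ffull _ _ (h (F X)))).
have etaE X : fmap F (eta X) = h (F X) := svalP (cid (Ffull _ _ (h (F X)))).
exists eta; split=> [X | X Y f] /=.
  have [g gE] := Ffull _ _ (h' (F X)).
  by exists g; split; apply: Ffaith; rewrite fmapM fmap1 etaE gE; have [] := h'P (F X).
by apply: Ffaith; rewrite !fmapM !etaE G1E !compA (h'P (F Y)).2 comp1m.
Qed.

Lemma zero_additive (A B : zmodType) : exists z : {additive A -> B}, forall x, z x = 0.
Proof. by apply: (@additive_of_fun A B (fun=> 0)) => x y; rewrite subr0. Qed.

(** * Full subcategories of abelian groups with concrete kernels and cokernels *)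

Section ConcreteAbelian.
Variables (C : category) (U : functor C Ab).

Definition uob (X : C) : zmodType := U X.
Definition umap (X Y : C) (f : Hom X Y) : {additive uob X -> uob Y} := fmap U f.

Hypotheses (Ufull : full U) (Ufaith : faithful U).
Hypothesis Uzero : exists Z : C, forall x : uob Z, x = 0.
Hypothesis Uker : forall (A B : C) (f : Hom A B), exists (K : C) (k : Hom K A),
  injective (umap k) /\ exact (umap k) (umap f).
Hypothesis Ucoker : forall (A B : C) (f : Hom A B), exists (Q : C) (q : Hom B Q),
  onto (umap q) /\ exact (umap f) (umap q).
Hypothesis Uprod : forall X Y : C, exists (P : C)
  (h : {additive uob P -> (uob X * uob Y)%type}), injective h /\ onto h.

Lemma umapM (X Y Z : C) (g : Hom Y Z) (f : Hom X Y) x : umap (g ∘ f) x = umap g (umap f x).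
Proof. by rewrite /umap fmapM. Qed.

Lemma umap1 (X : C) x : umap (idm X) x = x.
Proof. by rewrite /umap fmap1. Qed.

Lemma umap_full (X Y : C) (g : {additive uob X -> uob Y}) : exists f, umap f = g.
Proof. exact: Ufull. Qed.

Lemma umap_ext (X Y : C) (f g : Hom X Y) : umap f =1 umap g -> f = g.
Proof. by move=> fg; apply: Ufaith; exact: additive_ext. Qed.

Lemma trivial_is_zero (Z : C) : (forall x : uob Z, x = 0) -> is_zero_object Z.
Proof.
move=> Z0; split=> X.
  have [z zE] := zero_additive (uob X) (uob Z); have [f fE] := umap_full z.
  by exists f; split=> // g _; apply: umap_ext => x; rewrite [LHS]Z0 [RHS]Z0.
have [z zE] := zero_additive (uob Z) (uob X); have [f fE] := umap_full z.
by exists f; split=> // g _; apply: umap_ext => x; rewrite [x]Z0 !raddf0.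
Qed.

Lemma is_zero_morP (X Y : C) (f : Hom X Y) : is_zero_mor f <-> forall x, umap f x = 0.
Proof.
split=> [[Z [b [a [[Zt _] ->]]]] x | f0].
  have [z zE] := zero_additive (uob Z) (uob Z); have [g gE] := umap_full z.
  have [i [_ iU]] := Zt Z.
  (* On a zero object the identity equals the zero endomorphism. *)
  rewrite umapM -[umap a x]umap1 -(iU (idm Z) I) (iU g I) gE zE; exact: raddf0.
have [Z Z0] := Uzero.
have [z _] := zero_additive (uob X) (uob Z); have [a aE] := umap_full z.
have [z' _] := zero_additive (uob Z) (uob Y); have [b bE] := umap_full z'.
exists Z, b, a; split; first exact: trivial_is_zero.
by apply: umap_ext => x; rewrite f0 umapM [umap a x]Z0 raddf0.
Qed.

Local Lemma concrete_kernel (A B : C) (f : Hom A B) K (k : Hom K A) :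
  injective (umap k) -> exact (umap k) (umap f) -> is_kernel f k.
Proof.
move=> kI kf; split=> [|W g /is_zero_morP fg].
  by apply/is_zero_morP => x; rewrite umapM; apply/kf; exists x.
have [|x x' y y' e e'|y|u uE] := @additive_of_graph (uob W) (uob K)
    (fun x y => umap k y = umap g x).
- by move=> x; apply/kf; rewrite -umapM.
- by rewrite !raddfB e e'.
- by rewrite raddf0; exact: inj_raddf0.
have [v vE] := umap_full u; exists v; split=> [|w wE].
  by apply: umap_ext => x; rewrite umapM vE uE.
by apply: umap_ext => x; apply: kI; rewrite vE uE -wE umapM.
Qed.

(** A categorical kernel K is compared with the concrete one K0. Uniqueness of factorizations makes
    K -> K0 -> K the identity, which transports injectivity and exactness to K. *)
Lemma is_kernelP (A B : C) (f : Hom A B) K (k : Hom K A) :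
  is_kernel f k <-> injective (umap k) /\ exact (umap k) (umap f).
Proof.
split=> [[fk kU]|[]]; last exact: concrete_kernel.
have [K0 [k0 [k0I k0f]]] := Uker f.
have [fk0 k0U] := concrete_kernel k0I k0f.
have [u [uE _]] := kU _ _ fk0; have [w [wE _]] := k0U _ _ fk.
have [i [_ iU]] := kU _ _ fk.
have uw : u ∘ w = idm K.
  by rewrite -(iU (u ∘ w)) ?(iU (idm K)) ?compm1 // compA uE.
split.
  apply: raddf_inj0 => x; rewrite -wE umapM => /(inj_raddf0 k0I) wx.
  by rewrite -[x]umap1 -uw umapM wx raddf0.
move=> y; split=> [/k0f[z <-]|[x <-]]; first by exists (umap u z); rewrite -umapM uE.
by rewrite -umapM; move: x; apply/is_zero_morP.
Qed.

Local Lemma concrete_cokernel (A B : C) (f : Hom A B) Q (q : Hom B Q) :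
  onto (umap q) -> exact (umap f) (umap q) -> is_cokernel f q.
Proof.
move=> qS fq; split=> [|W g /is_zero_morP gf].
  by apply/is_zero_morP => x; rewrite umapM; apply/fq; exists x.
have [||y [x [/fq[z <-] <-]]|u uE] := @additive_of_graph (uob Q) (uob W)
    (fun y w => exists x, umap q x = y /\ umap g x = w).
- by move=> y; have [x <-] := qS y; exists (umap g x), x.
- by move=> _ _ _ _ [x [<- <-]] [x' [<- <-]]; exists (x - x'); rewrite !raddfB.
- by rewrite -umapM.
have uq x : u (umap q x) = umap g x.
  have [x' [qx' <-]] := uE (umap q x); apply/eqP; rewrite -subr_eq0 -raddfB.
  have /fq[z <-] : umap q (x' - x) = 0 by rewrite raddfB qx' subrr.
  by rewrite -umapM gf.
have [v vE] := umap_full u; exists v; split=> [|w wE].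
  by apply: umap_ext => x; rewrite umapM vE uq.
by apply: umap_ext => y; have [x <-] := qS y; rewrite vE uq -wE umapM.
Qed.

Lemma is_cokernelP (A B : C) (f : Hom A B) Q (q : Hom B Q) :
  is_cokernel f q <-> onto (umap q) /\ exact (umap f) (umap q).
Proof.
split=> [[qf qU]|[]]; last exact: concrete_cokernel.
have [Q0 [q0 [q0S q0f]]] := Ucoker f.
have [q0z q0U] := concrete_cokernel q0S q0f.
have [u [uE _]] := qU _ _ q0z; have [w [wE _]] := q0U _ _ qf.
have [i [_ iU]] := qU _ _ qf.
have wu : w ∘ u = idm Q.
  by rewrite -(iU (w ∘ u)) ?(iU (idm Q)) ?comp1m // -compA uE.
split=> [y|y].
  have [x xE] := q0S (umap u y); exists x.
  by rewrite -wE umapM xE -umapM wu umap1.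
split=> [qy|[x <-]]; last by rewrite -umapM; move: x; apply/is_zero_morP.
by apply/q0f; rewrite -uE umapM qy raddf0.
Qed.

Lemma mono_injective (A B : C) (f : Hom A B) : is_mono f -> injective (umap f).
Proof.
move=> fM; have [K [k [kI kf]]] := Uker f.
have [z zE] := zero_additive (uob K) (uob A); have [n nE] := umap_full z.
have kn : k = n.
  apply: fM; apply: umap_ext => x; rewrite !umapM nE zE raddf0.
  by apply/kf; exists x.
by apply: raddf_inj0 => x /kf[y <-]; rewrite kn nE zE.
Qed.

Lemma epi_surjective (A B : C) (f : Hom A B) : is_epi f -> onto (umap f).
Proof.
move=> fE; have [Q [q [qS fq]]] := Ucoker f.
have [z zE] := zero_additive (uob B) (uob Q); have [n nE] := umap_full z.
have qn : q = n.
  apply: fE; apply: umap_ext => x; rewrite !umapM nE zE.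
  by apply/fq; exists x.
by move=> y; apply/fq; rewrite qn nE zE.
Qed.

Lemma concrete_abelian : is_abelian C.
Proof.
split.
- by have [Z Z0] := Uzero; exists Z; exact: trivial_is_zero.
- move=> X Y; have [P [h [hI hS]]] := Uprod X Y.
  have [|p' p'E] := @additive_of_fun (uob P) (uob X) (fun x => (h x).1).
    by move=> x y; rewrite raddfB.
  have [|q' q'E] := @additive_of_fun (uob P) (uob Y) (fun x => (h x).2).
    by move=> x y; rewrite raddfB.
  have [p pE] := umap_full p'; have [q qE] := umap_full q'.
  exists P, p, q => W f g.
  have [hi [hK hiK]] := additive_inverse hI hS.
  have [|u' u'E] := @additive_of_fun (uob W) (uob P) (fun x => hi (umap f x, umap g x)).
    by move=> x y; rewrite !raddfB -(raddfB hi).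
  have [u uE] := umap_full u'; exists u; split.
    by split; apply: umap_ext => x; rewrite umapM uE u'E ?pE ?p'E ?qE ?q'E hiK.
  move=> v [vf vg]; apply: umap_ext => x; apply: hI; rewrite uE u'E hiK -vf -vg.
  by rewrite !umapM pE p'E qE q'E -surjective_pairing.
- move=> X Y; have [P [h [hI hS]]] := Uprod X Y.
  have [hi [hK hiK]] := additive_inverse hI hS.
  have [|i' i'E] := @additive_of_fun (uob X) (uob P) (fun x => hi (x, 0)).
    by move=> x y; rewrite -(raddfB hi); congr (hi (_, _)); rewrite subr0.
  have [|j' j'E] := @additive_of_fun (uob Y) (uob P) (fun x => hi (0, x)).
    by move=> x y; rewrite -(raddfB hi); congr (hi (_, _)); rewrite subr0.
  have [i iE] := umap_full i'; have [j jE] := umap_full j'.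
  exists P, i, j => W f g.
  have [|u' u'E] := @additive_of_fun (uob P) (uob W) (fun x => umap f (h x).1 + umap g (h x).2).
    by move=> x y; rewrite !raddfB /=; zmod.
  have [u uE] := umap_full u'; exists u; split.
    split; apply: umap_ext => x; rewrite umapM uE u'E ?iE ?i'E ?jE ?j'E hiK /=.
      by rewrite raddf0 addr0.
    by rewrite raddf0 add0r.
  move=> v [vf vg]; apply: umap_ext => x; rewrite uE u'E -vf -vg !umapM iE i'E jE j'E -!raddfD.
  rewrite -{3}[x]hK; congr (umap v (hi _)).
  by apply: injective_projections; rewrite /= ?addr0 ?add0r.
- by move=> A B f; have [K [k kP]] := Uker f; exists K, k; apply/is_kernelP.
- by move=> A B f; have [Q [q qP]] := Ucoker f; exists Q, q; apply/is_cokernelP.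
- move=> A B f /mono_injective fI; have [Q [q [qS fq]]] := Ucoker f.
  by exists Q, q; apply/is_kernelP.
- move=> A B f /epi_surjective fS; have [K [k [kI kf]]] := Uker f.
  by exists K, k; apply/is_cokernelP.
Qed.

End ConcreteAbelian.

(** * Reduced cotorsion groups *)

Lemma kernel_object (A B : zmodType) (f : {additive A -> B}) :
  exists (K : zmodType) (k : {additive K -> A}), injective k /\ exact k f.
Proof.
apply: (@subgroup_object A (fun x => f x = 0)).
by split=> [|x y fx fy]; rewrite ?raddf0 // raddfB fx fy subrr.
Qed.

Lemma cokernel_object (A B : zmodType) (f : {additive A -> B}) :
  exists (Q : zmodType) (q : {additive B -> Q}), onto q /\ exact f q.
Proof.
apply: (@quotient_object B (fun y => exists x, f x = y)).
split=> [|_ _ [x <-] [y <-]]; first by exists 0; rewrite raddf0.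
by exists (x - y); rewrite raddfB.
Qed.

Lemma reduced_cotorsion_kernel (A B K : zmodType) (f : {additive A -> B})
    (k : {additive K -> A}) :
  injective k -> exact k f -> reduced_cotorsion A -> reduced_cotorsion B -> reduced_cotorsion K.
Proof.
move=> kI kf /reduced_cotorsionP tA /reduced_cotorsionP tB; apply/reduced_cotorsionP => m mc.
by have [sA rA] := tA m mc; have [_ rB] := tB m mc; exact: (telescopic_kernel kI kf).
Qed.

Lemma reduced_cotorsion_cokernel (A B Q : zmodType) (f : {additive A -> B})
    (q : {additive B -> Q}) :
  onto q -> exact f q -> reduced_cotorsion A -> reduced_cotorsion B -> reduced_cotorsion Q.
Proof.
move=> qS fq /reduced_cotorsionP tA /reduced_cotorsionP tB; apply/reduced_cotorsionP => m mc.
by have [sA _] := tA m mc; exact: (telescopic_cokernel qS fq sA (tB m mc)).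
Qed.

Lemma reduced_cotorsion_extension : closed_under_extensions reduced_cotorsion.
Proof.
move=> F C X /reduced_cotorsionP tC /reduced_cotorsionP tF; apply/reduced_cotorsionP => m mc.
by apply: telescopic_extension; [exact: tC | exact: tF].
Qed.

Lemma reduced_cotorsion_product : closed_under_products reduced_cotorsion.
Proof.
move=> I A tA; apply/reduced_cotorsionP => m mc; apply: telescopic_product => i.
by have /reduced_cotorsionP := tA i; exact.
Qed.

Lemma product_void_trivial (A : void -> zmodType) (x : product_group A) : x = 0.
Proof. by apply: functional_extensionality_dep => -[]. Qed.

Lemma Ab_is_kernelP (A B : Ab) (f : Hom A B) K (k : Hom K A) :
  is_kernel f k <-> injective (umap (id_functor Ab) k) /\
    exact (umap (id_functor Ab) k) (umap (id_functor Ab) f).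
Proof.
apply: is_kernelP => //.
- by move=> X Y g; exists g.
- by exists (product_group (fun _ : void => int) : zmodType); exact: product_void_trivial.
- by move=> X Y g; exact: kernel_object.
Qed.

Lemma Ab_is_cokernelP (A B : Ab) (f : Hom A B) Q (q : Hom B Q) :
  is_cokernel f q <-> onto (umap (id_functor Ab) q) /\
    exact (umap (id_functor Ab) f) (umap (id_functor Ab) q).
Proof.
apply: is_cokernelP => //.
- by move=> X Y g; exists g.
- by exists (product_group (fun _ : void => int) : zmodType); exact: product_void_trivial.
- by move=> X Y g; exact: cokernel_object.
Qed.

Local Notation RedCot_Ab := (@inclusion_functor Ab reduced_cotorsion).

Lemma RedCot_full : full RedCot_Ab. Proof. by move=> X Y g; exists g. Qed.
Lemma RedCot_faithful : faithful RedCot_Ab. Proof. by []. Qed.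

Lemma RedCot_zero : exists Z : RedCot, forall x : uob RedCot_Ab Z, x = 0.
Proof.
(* Presented as an empty product, the zero group is covered by closure under products. *)
have P0 : reduced_cotorsion (product_group (fun _ : void => int)).
  by apply: reduced_cotorsion_product => -[].
by exists (exist _ _ P0); exact: product_void_trivial.
Qed.

Lemma RedCot_kernel (A B : RedCot) (f : Hom A B) : exists (K : RedCot) (k : Hom K A),
  injective (umap RedCot_Ab k) /\ exact (umap RedCot_Ab k) (umap RedCot_Ab f).
Proof.
have [K [k [kI kf]]] := kernel_object (umap RedCot_Ab f).
by exists (exist _ K (reduced_cotorsion_kernel kI kf (svalP A) (svalP B))), k.
Qed.

Lemma RedCot_cokernel (A B : RedCot) (f : Hom A B) : exists (Q : RedCot) (q : Hom B Q),
  onto (umap RedCot_Ab q) /\ exact (umap RedCot_Ab f) (umap RedCot_Ab q).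
Proof.
have [Q [q [qS fq]]] := cokernel_object (umap RedCot_Ab f).
by exists (exist _ Q (reduced_cotorsion_cokernel qS fq (svalP A) (svalP B))), q.
Qed.

Lemma RedCot_is_abelian : is_abelian RedCot.
Proof.
apply: (concrete_abelian RedCot_full RedCot_faithful RedCot_zero RedCot_kernel RedCot_cokernel).
move=> X Y.
(* The direct sum is the middle term of a split extension. *)
have XY := reduced_cotorsion_extension (split_extension (sval Y) (sval X)) (svalP X) (svalP Y).
exists (exist _ _ XY), (additive_id (sval X * sval Y)%type); split=> // x.
by exists x.
Qed.

(** In both categories, kernels and cokernels are characterized by the same conditions on underlying
    groups. *)
Lemma RedCot_exact : is_exact_functor RedCot_Ab.
Proof.
move=> X Y Z f g [/(is_kernelP RedCot_full RedCot_faithful RedCot_zero RedCot_kernel) k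
  /(is_cokernelP RedCot_full RedCot_faithful RedCot_zero RedCot_cokernel) c].
by split; [apply/Ab_is_kernelP | apply/Ab_is_cokernelP].
Qed.

(** * The product functor on families of contramodules *)

Lemma product_coordinate (I : eqType) (A : I -> zmodType) i (x : A i) :
  exists w : product_group A, w i = x.
Proof. by exists (dfwith (fun j => 0 : A j) x); exact: dfwith_in. Qed.

Lemma contramodule_product_reduced_cotorsion (X : product_category Contra) :
  reduced_cotorsion (product_functor X).
Proof.
by apply: reduced_cotorsion_product => p; exact: contramodule_reduced_cotorsion (svalP (X p)).
Qed.

Local Notation contramodule_product :=
  (corestrict_functor contramodule_product_reduced_cotorsion).

Lemma contramodule_product_faithful : faithful contramodule_product.
Proof.
move=> X Y f g fg; apply: functional_extensionality_dep => p; apply: additive_ext => x.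
have [w wx] := @product_coordinate prime_number (fun p => sval (X p)) p x.
have := congr1 (fun h : {additive product_group (fun p => sval (X p)) ->
  product_group (fun p => sval (Y p))} => h w p) fg.
by rewrite /= /product_map wx.
Qed.

(* A homomorphism into a q-contramodule kills every p-divisible element,
   in particular the product of the p-contramodules over p different from q. *)
Lemma contramodule_product_full : full contramodule_product.
Proof.
move=> X Y g.
pose A := product_group (fun p => sval (X p)); pose B := product_group (fun p => sval (Y p)).
pose G : {additive A -> B} := g.
have [f fP] : exists f : (forall p, {additive sval (X p) -> sval (Y p)}),
    forall p (w : A), f p (w p) = G w p.
  suff fp p : exists h : {additive sval (X p) -> sval (Y p)}, forall w : A, h (w p) = G w p.
    by exists (fun p => sval (cid (fp p))) => p; exact: (svalP (cid (fp p))).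
  have kill (w : A) : w p = 0 -> G w p = 0.
    move=> wp; have [|Gp GpE] := @additive_of_fun A (sval (Y p)) (fun w => G w p).
      by move=> x y; rewrite raddfB.
    have [_ rY] := (contramoduleP p (sval (Y p))).1 (svalP (Y p)).
    rewrite -GpE; apply: (telescopic_prime_rigid_hom Gp rY).
    have z q : coprimary (val p) (w q).
      have [<-|neq] := eqVneq p q.
        by exists (fun=> 0); rewrite wp; split=> // n; rewrite mul0rn.
      apply: (telescopic_prime_coprimary (valP p) (valP q)).
        by rewrite (inj_eq val_inj).
      by apply/contramoduleP; exact: (svalP (X q)).
    exists (fun n q => sval (cid (z q)) n); split=> [|n]; apply: functional_extensionality_dep => q.
      by have [] := svalP (cid (z q)).
    by rewrite product_groupMn; have [_] := svalP (cid (z q)).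
  (* The value at x is read off from any w with p-coordinate x; [kill] makes it independent of w. *)
  have [x|x x' _ _ [w [<- <-]] [w' [<- <-]]|y [w [wp <-]]|h hE] :=
    @additive_of_graph (sval (X p)) (sval (Y p)) (fun x y => exists w : A, w p = x /\ G w p = y).
  - by have [w <-] := @product_coordinate prime_number (fun p => sval (X p)) p x; exists (G w p), w.
  - by exists (w - w'); rewrite raddfB.
  - exact: kill.
  exists h => w; have [w' [w'p <-]] := hE (w p); apply/eqP; rewrite -subr_eq0; apply/eqP.
  have : G (w' - w) p = 0 by apply: kill; rewrite -[LHS]/(w' p - w p) w'p subrr.
  by rewrite raddfB.
exists f; apply: additive_ext => w; apply: functional_extensionality_dep => p; exact: fP.
Qed.

Lemma contramodule_product_surjective : essentially_surjective contramodule_product.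
Proof.
move=> [C Crc].
have [K [pi [f [tK _ _ [fI fS]]]]] := primary_product ((reduced_cotorsionP C).1 Crc).
pose X : product_category Contra := fun p => exist _ (K p) ((contramoduleP p (K p)).2 (tK p)).
have [g [fK gK]] := additive_inverse fI fS.
exists X, g, f; split; apply: additive_ext => x; [exact: gK | exact: fK].
Qed.

Theorem corollary12p11 :
  ((@closed_under_kernels Ab reduced_cotorsion /\
    @closed_under_cokernels Ab reduced_cotorsion /\
    closed_under_extensions reduced_cotorsion /\
    closed_under_products reduced_cotorsion) /\
   (is_abelian RedCot /\
    is_exact_functor (@inclusion_functor Ab reduced_cotorsion))) /\
  (exists prod_in_RedCot :
      forall X : product_category Contra, reduced_cotorsion (product_functor X),
    is_equivalence (@corestrict_functor (product_category Contra) Ab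
      reduced_cotorsion product_functor prod_in_RedCot)).
Proof.
split.
  split; last by split; [exact: RedCot_is_abelian | exact: RedCot_exact].
  split; last split; last split.
  - move=> A B f K k PA PB /Ab_is_kernelP[kI kf]; exact: reduced_cotorsion_kernel kI kf PA PB.
  - move=> A B f Q q PA PB /Ab_is_cokernelP[qS fq]; exact: reduced_cotorsion_cokernel qS fq PA PB.
  - exact: reduced_cotorsion_extension.
  - exact: reduced_cotorsion_product.
exists contramodule_product_reduced_cotorsion; apply: full_faithful_equivalence.
- exact: contramodule_product_full.
- exact: contramodule_product_faithful.
- exact: contramodule_product_surjective.
Qed.
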